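(* Suppose $L_T\gtrsim 1/\sqrt T$ and $\mathcal L^{\mathrm{perish}}\gtrsim 1/\sqrt T$. Then the algorithm Perishing-Guardrail, run with envy parameter $L_T$ and high-probability parameter $\delta\in(0,1)$, achieves with probability at least $1-2\delta$: $$\Delta_{EF}\lesssim\max\{L_T,\mathcal L^{\mathrm{perish}}\},\qquad \Delta_{\mathrm{efficiency}}\lesssim T\mathcal L^{\mathrm{perish}} .$$
   Context: Model. A decision-maker has a set $\mathcal B$ of $B$ divisible units of a single resource to allocate over rounds $t\in[T]=\{1,\dots,T\}$. Individuals have types in a finite set $\Theta$; type $\theta$ has utility $w_\theta x$ for an amount $x\ge0$, $w_\theta>0$. In round $t$ a random number $N_{t,\theta}$ of type-$\theta$ individuals arrives; the $N_{t,\theta}$ are independent with known distributions and $N_{t,\theta}\ge1$ a.s. $N_t=\sum_\theta N_{t,\theta}$, $N=\sum_{t\in[T]}N_t$, $\mathbb E[N]=\Theta(T)$, $\beta_{avg}=B/\mathbb E[N]=\Theta(1)$. $\sigma_{t,\theta}^2=\mathrm{Var}(N_{t,\theta})<\infty$; $\rho_{t,\theta}<\infty$ is an almost sure bound on $|N_{t,\theta}-\mathbb E[N_{t,\theta}]|$; $w_{max}=\max_\theta w_\theta$, $\mu_{\max}=\max_t\mathbb E[N_t]$, $\sigma^2_{\min}=\min\sigma^2_{t,\theta}$, $\sigma^2_{\max}=\max\sigma^2_{t,\theta}$, $\rho_{\max}=\max\rho_{t,\theta}$. Unit $b$ has a random perishing time $T_b\in\{1,2,\dots\}$ with known distribution,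 independent across units and of arrivals; any unallocated part of $b$ spoils at the end of round $T_b$, after that round's allocation. A fixed allocation schedule is a bijection $\sigma:\mathcal B\to\{1,\dots,B\}$; units are handed out in increasing order of $\sigma$ among those still (partly) unallocated and unspoiled. $X^{alg}_{t,\theta}$ is the amount given to each type-$\theta$ individual in round $t$; $B_1^{alg}=B$ and $B_{t+1}^{alg}=B_t^{alg}-\sum_\theta N_{t,\theta}X^{alg}_{t,\theta}-PUA^{alg}_t$, with $PUA_t^{alg}$ the quantity of unallocated resource perishing at the end of round $t$. For time-indexed $Y_t$: $Y_{<t}=\sum_{t'<t}Y_{t'}$, and similarly $Y_{\le t},Y_{>t},Y_{\ge t},Y_{(t,t']},Y_{[t,t']}$. Metrics. $\Delta_{EF}=\max_{t,\theta}|w_\theta(X^{alg}_{t,\theta}-B/N)|$; $\Delta_{\mathrm{efficiency}}=B-\sum_{t,\theta}N_{t,\theta}X^{alg}_{t,\theta}$. Confidence terms. For $t'>t$, $\mathrm{Conf}^N_{t,t'}=\sqrt{2(t'-t)|\Theta|\rho_{\max}^2\log(2T^2/\delta)}$ ($\mathrm{Conf}^N_{t,t}=0$), and $\mathrm{Conf}^P_t(\eta)=\frac12\big(\log(3t\log T/\delta)+\sqrt{\log^2(3t\log T/\delta)+8\eta\log(3t\log T/\delta)}\big)$. Forecasts. $\overline N=\mathbb E[N]+\mathrm{Conf}^N_{0,T}$, $\overline N_{>t}=\mathbb E[N_{>t}]+\mathrm{Conf}^N_{t,T}$, $\underline N_{[t,t']}=\mathbb E[N_{[t,t']}]-\mathrm{Conf}^N_{t-1,t'}$,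 $\underline N_{\le t}=\underline N_{[1,t]}$, $\underline N_{<t}=\underline N_{[1,t-1]}$ ($\underline N_{<1}=0$). For $X\ge0$, $$\tau_b(t\mid X,\sigma)=\inf\{t'\ge t:\underline N_{<t}X+\underline N_{[t,t']}X\ge\sigma(b)\}\ (\inf\emptyset=\infty),\ \text{and for } t=1:\ \tau_b(1\mid X,\sigma)=\inf\{t'\ge1:\underline N_{\le t'}X\ge\sigma(b)\},$$ $$\mu(X)=\sum_{b\in\mathcal B}\Pr(T_b<\min\{T,\tau_b(1\mid X,\sigma)\}),\quad \overline\Delta(X)=\min\{B,\mu(X)+\mathrm{Conf}^P_1(\mu(X))\},$$ $$\underline X=\sup\{X\mid X\le (B-\overline\Delta(X))/\overline N\}\ \text{(assumed attained)},\quad \mathcal L^{\mathrm{perish}}=B/\overline N-\underline X .$$ $\overline{\mathcal B}_t$ is the set of units of rank at least $\lceil\underline N_{<t}\underline X\rceil$ in $\sigma$, $\eta_t=\sum_{b\in\overline{\mathcal B}_t}\Pr(t\le T_b<\min\{T,\tau_b(t\mid\underline X,\sigma)\})$, $\overline P_0=B$, $\overline P_t=\min\{\overline P_{t-1},\eta_t+\mathrm{Conf}^P_t(\eta_t)\}$. Algorithm Perishing-Guardrail. Input $L_T=o(1)$. Set $\overline X=\underline X+L_T$. In each round $t=1,\dots,T$, after observing $N_t$: if $B_t^{alg}<N_t\underline X$, set $X^{alg}_{t,\theta}=B_t^{alg}/N_t$ for all $\theta$; else if $B_t^{alg}-N_t\overline X\ge\underline X\,\overline N_{>t}+\overline P_t$,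 set $X^{alg}_{t,\theta}=\overline X$ for all $\theta$; else set $X_{t,\theta}^{alg}=\underline X$ for all $\theta$. Allocate the remaining units according to $\sigma$. Notation. $\lesssim$ and $\gtrsim$ mean that the inequality holds as $T$ grows up to absolute constants and polynomial factors of $\beta_{avg},|\Theta|,w_{max},\mu_{\max},\sigma^2_{\min},\sigma^2_{\max},\rho_{\max},\log T,\log(1/\delta)$. *)

(* Defs.v *)
(* The notations of multinomials clash with those of MathComp-Analysis, so
   mpoly is imported without them. *)
From HB Require Import structures.
From mathcomp Require Import all_boot all_order all_algebra.
From mathcomp Require Import all_fingroup.
From mathcomp Require Import all_classical all_reals all_analysis.
From mathcomp Require Export -(notations) mpoly.

Set Implicit Arguments.
Unset Strict Implicit.
Unset Printing Implicit Defensive.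

Import Order.TTheory GRing.Theory Num.Theory.
Import numFieldNormedType.Exports.

Local Open Scope classical_set_scope.
Local Open Scope ring_scope.

(* Every subset of nat is measurable, so A ranges over all families of sets. *)
Definition mutually_independent (R : realType) (d : measure_display)
    (Omega : measurableType d) (P : probability Omega R) (I : finType)
    (X : I -> Omega -> nat) : Prop :=
  forall (J : {set I}) (A : I -> set nat),
    P (\bigcap_(i in [set` J]) (X i @^-1` A i)) =
    (\prod_(i in J) P (X i @^-1` A i))%E.

(* An instance of the allocation problem with rounds 1, ..., T.  Time-indexed
   data are functions of a natural number whose values outside [1, T] are
   irrelevant.  The units are the elements of 'I_nunits, and unit b has rank
   (sched b).+1 in the fixed allocation schedule. *)
Record instance (R : realType) (T : nat) := Instance {
  types : finType;
  weight : types -> R;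
  nunits : nat;
  sched : {perm 'I_nunits};
  disp : measure_display;
  Omega : measurableType disp;
  Pr : probability Omega R;
  arrivals : nat -> types -> {RV Pr >-> nat};
  rho : nat -> types -> R;
  perish : 'I_nunits -> {RV Pr >-> nat};
  weight_gt0 : forall theta, 0 < weight theta;
  arrivals_ge1 : forall t theta, (1 <= t <= T)%N ->
    {ae Pr, forall w, (1 <= arrivals t theta w)%N};
  arrivals_var : forall t theta, (1 <= t <= T)%N ->
    ('V_Pr[fun w => (arrivals t theta w)%:R : R] < +oo)%E;
  arrivals_bound : forall t theta, (1 <= t <= T)%N ->
    {ae Pr, forall w,
      `|(arrivals t theta w)%:R
        - fine 'E_Pr[fun w' => (arrivals t theta w')%:R : R]| <= rho t theta};
  perish_ge1 : forall b w, (1 <= perish b w)%N;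
  independence : mutually_independent Pr
    (fun i : 'I_T * types + 'I_nunits =>
       match i with
       | inl p => arrivals p.1.+1 p.2 : Omega -> nat
       | inr b => perish b : Omega -> nat
       end)
}.

Section Model.
Variables (R : realType) (T : nat) (I : instance R T).

Local Notation types := (types I).
Local Notation P := (Pr I).
Local Notation units := 'I_(nunits I).

Definition resource : R := (nunits I)%:R.
Definition rank (b : units) : nat := (sched I b).+1.

Definition arr (t : nat) (theta : types) (w : Omega I) : R :=
  (arrivals t theta w)%:R.
Definition arr_tot (t : nat) (w : Omega I) : R := \sum_(theta : types) arr t theta w.

(* N_{[t, t']}, with N_{> t} = N_{[t + 1, T]} and N_{< t} = N_{[1, t - 1]} *)
Definition arr_int (t t' : nat) (w : Omega I) : R :=
  \sum_(t <= s < t'.+1) arr_tot s w.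
Definition exp_int (t t' : nat) : R := fine 'E_P[arr_int t t'].

Definition beta_avg : R := resource / exp_int 1 T.
Definition sigma2 (t : nat) (theta : types) : R := fine 'V_P[arr t theta].

(* The maxima below are of nonnegative numbers, hence the default value 0. *)
Definition w_max : R := \big[Num.max/0]_(theta : types) weight theta.
Definition mu_max : R := \big[Num.max/0]_(1 <= t < T.+1) exp_int t t.
Definition sigma2_max : R :=
  \big[Num.max/0]_(1 <= t < T.+1) \big[Num.max/0]_(theta : types) sigma2 t theta.
Definition sigma2_min : R :=
  \big[Num.min/sigma2_max]_(1 <= t < T.+1)
    \big[Num.min/sigma2_max]_(theta : types) sigma2 t theta.
Definition rho_max : R :=
  \big[Num.max/0]_(1 <= t < T.+1) \big[Num.max/0]_(theta : types) rho t theta.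

Section Confidence.
Variable delta : R.

Definition params (i : 'I_9) : R :=
  nth 0 [:: beta_avg; #|types|%:R; w_max; mu_max; sigma2_min; sigma2_max;
            rho_max; ln T%:R; ln (1 / delta)] i.

Definition confN (t t' : nat) : R :=
  Num.sqrt (2 * (t' - t)%:R * #|types|%:R * rho_max ^+ 2
            * ln (2 * T%:R ^+ 2 / delta)).
Definition confP (t : nat) (eta : R) : R :=
  let l := ln (3 * t%:R * ln T%:R / delta) in
  (l + Num.sqrt (l ^+ 2 + 8 * eta * l)) / 2.

Definition N_up : R := exp_int 1 T + confN 0 T.
Definition N_up_gt (t : nat) : R := exp_int t.+1 T + confN t T.
Definition N_low (t t' : nat) : R := exp_int t t' - confN t.-1 t'.
Definition N_low_lt (t : nat) : R := N_low 1 t.-1.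

(* Rounds beyond T do not exist; since tau is only compared with T through
   min {T, tau}, restricting the infimum to t' <= T is immaterial.  For t = 1,
   N_low_lt 1 = 0. *)
Definition tau (b : units) (t : nat) (X : R) : \bar R :=
  ereal_inf [set (t'%:R)%:E | t' in
    [set t' : nat | (t <= t' <= T)%N /\
                    ((rank b)%:R <= N_low_lt t * X + N_low t t' * X)%R]].

Definition prob_perish (b : units) (t : nat) (X : R) : R :=
  fine (P [set w | (t <= perish b w)%N /\
    (((perish b w)%:R : R)%:E < mine (T%:R)%:E (tau b t X))%E]).

(* As T_b >= 1, the condition 1 <= T_b in prob_perish b 1 X is void. *)
Definition mu (X : R) : R := \sum_(b : units) prob_perish b 1 X.
Definition Delta_up (X : R) : R := Num.min resource (mu X + confP 1 (mu X)).

Definition feasible : set R :=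
  [set X | 0 <= X /\ X <= (resource - Delta_up X) / N_up].
Definition X_low : R := sup feasible.
Definition L_perish : R := resource / N_up - X_low.

Definition eta (t : nat) : R :=
  \sum_(b : units | Num.ceil (N_low_lt t * X_low) <= (rank b)%:Z)
    prob_perish b t X_low.
Fixpoint P_up (t : nat) : R :=
  if t is t'.+1 then Num.min (P_up t') (eta t + confP t (eta t)) else resource.

Section Algorithm.
Variable L : R.

Definition X_up : R := X_low + L.

(* The amount given to every individual in round t, when Bt is the remaining
   budget at the beginning of the round. *)
Definition guardrail (t : nat) (w : Omega I) (Bt : R) : R :=
  let Nt := arr_tot t w in
  if Bt < Nt * X_low then Bt / Nt
  else if X_low * N_up_gt t + P_up t <= Bt - Nt * X_up then X_up
  else X_low.

(* What is left of each unit after handing out an amount A in increasing order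
   of rank, rem b being the available part of unit b. *)
Definition hand_out (rem : units -> R) (A : R) (b : units) : R :=
  rem b - Num.min (rem b)
    (Num.max 0 (A - \sum_(b' : units | (rank b' < rank b)%N) rem b')).

(* The state after round t: the budget B_{t + 1} and the part of each unit that
   is neither allocated nor spoiled. *)
Fixpoint state (w : Omega I) (t : nat) : R * (units -> R) :=
  if t is s.+1 then
    let: (Bt, rem) := state w s in
    let A := \sum_(theta : types) arr t theta w * guardrail t w Bt in
    let rem' := hand_out rem A in
    let PUA := \sum_(b : units | perish b w == t) rem' b in
    (Bt - A - PUA, fun b => if (perish b w <= t)%N then 0 else rem' b)
  else (resource, fun=> 1).

Definition budget (t : nat) (w : Omega I) : R := (state w t.-1).1.
Definition X_alg (t : nat) (theta : types) (w : Omega I) : R :=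
  guardrail t w (budget t w).

Definition Delta_EF (w : Omega I) : R :=
  \big[Num.max/0]_(1 <= t < T.+1) \big[Num.max/0]_(theta : types)
    `|weight theta * (X_alg t theta w - resource / arr_int 1 T w)|.
Definition Delta_efficiency (w : Omega I) : R :=
  resource - \sum_(1 <= t < T.+1) \sum_(theta : types)
    arr t theta w * X_alg t theta w.

End Algorithm.
End Confidence.
End Model.

(* Hidden factors of an asymptotic inequality: polynomials with nonnegative
   coefficients, including the constant ones, in the nine quantities params. *)
Definition hidden_factor (R : realType) (p : mpoly 9 R) : Prop :=
  forall m, 0 <= mcoeff m p.

(* Main.v *)
(* With probability at least 1 - delta, by Hoeffding's inequality and a union
   bound over windows of rounds, every N_[t, t'] is within Conf^N of its mean;
   with probability at least 1 - delta, by the Chernoff bound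
   P(S >= eta + c) <= exp (- c^2 / (2 eta + c)), the number of units that would
   perish from round t on if every round handed out X_low per individual is at
   most eta_t + Conf^P_t(eta_t) for all t.  Outside these two bad events the
   budget at the start of each round t is at least N_t X_low, so the algorithm
   only ever allocates X_low or X_low + L: from the last round s in which it
   chose the larger amount (or from the start), the guardrail test (or the
   feasibility of X_low) has reserved X_low per future arrival plus all that can
   still perish.  Hence allocations differ from B / N by at most
   L_perish + L + O(beta_avg Conf^N / T), and at least N X_low is handed out, which
   leaves at most N_up L_perish + 2 Conf^N X_low.  As Conf^N is of order sqrt T up
   to hidden factors, both hypotheses 1 / sqrt T <~ L, L_perish absorb it. *)
Require Import Defs.
From mathcomp Require Import all_boot all_order all_algebra.
From mathcomp Require Import all_fingroup.
From mathcomp Require Import all_classical all_reals all_analysis.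
From mathcomp Require Import measurable_realfun ring lra zify.
Import Order.TTheory GRing.Theory Num.Theory.
Import numFieldNormedType.Exports.
Local Open Scope classical_set_scope.
Local Open Scope ring_scope.
Set Implicit Arguments.
Unset Strict Implicit.
Unset Printing Implicit Defensive.

(** * Real inequalities *)

Section RealInequalities.
Context {R : realType}.
Implicit Types x l c : R.

Lemma ge0_derive_le (f f' : R -> R) x :
  (forall y : R, is_derive y 1 f (f' y)) -> (forall y, 0 <= y <= x -> 0 <= f' y) ->
  0 <= x -> f 0 <= f x.
Proof.
move=> df f'_ge0 x_ge0.
have cf : {within `[0, x], continuous f}.
  apply: continuous_subspaceT => y; apply: differentiable_continuous.
  by apply/derivable1_diffP; have [] := df y.
have [y] := MVT_segment x_ge0 (fun y _ => df y) cf.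
rewrite in_itv/= => y0x /eqP; rewrite subr0 subr_eq => /eqP ->.
by rewrite lerDr mulr_ge0// f'_ge0.
Qed.

(** The Padé-type bound exp x <= (2 + x) / (2 - x) with the denominator cleared, so that no upper
    bound on [x] is required. The difference of the sides vanishes at 0 and has derivative 1 - exp y
    (1 - y), nonnegative because exp (- y) >= 1 - y. *)
Lemma expR_le_div x : 0 <= x -> expR x * (2 - x) <= 2 + x.
Proof.
move=> x0.
pose f y : R := 2 + y - expR y * (2 - y).
pose f' y : R := 1 - expR y * (1 - y).
suff : f 0 <= f x by rewrite /f expR0; lra.
apply: (@ge0_derive_le f f') => // [y|y _].
  rewrite /f /f'; apply: is_derive_eq; rewrite /GRing.scale/=; lra.
rewrite subr_ge0 -(ler_pM2l (expR_gt0 (- y))) mulrA -expRD addNr expR0 mul1r mulr1.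
by have := expR_ge1Dx (- y).
Qed.

(** The function cosh z * exp (- z^2 / 2) decreases on z >= 0 because tanh z <= z; both facts come
    from the sign of a derivative, and evenness covers x < 0. *)
Lemma cosh_le x : (expR x + expR (- x)) / 2 <= expR (x ^+ 2 / 2).
Proof.
wlog x0 : x / 0 <= x => [hw|].
  have [|x0] := leP 0 x; first exact: hw.
  have := hw (- x); rewrite opprK sqrrN addrC; apply; lra.
have sinh_ge0 (y : R) : 0 <= y -> expR (- y) <= expR y by move=> y0; rewrite ler_expR; lra.
have tanh_le (y : R) : 0 <= y ->
    expR y - expR (- y) <= y * (expR y + expR (- y)).
  move=> y0.
  pose f z : R := z * (expR z + expR (- z)) - (expR z - expR (- z)).
  pose f' z : R := z * (expR z - expR (- z)).
  suff : f 0 <= f y by rewrite /f oppr0 expR0; lra.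
  apply: (@ge0_derive_le f f') => // [z|z /andP[z0 _]].
    rewrite /f /f'; apply: is_derive_eq; rewrite /GRing.scale/=; ring.
  by rewrite /f' mulr_ge0// subr_ge0 sinh_ge0.
pose f z : R := - ((expR z + expR (- z)) * expR (- (z ^+ 2 / 2))).
pose f' z : R := (z * (expR z + expR (- z)) - (expR z - expR (- z)))
  * expR (- (z ^+ 2 / 2)).
have : f 0 <= f x.
  apply: (@ge0_derive_le f f') => // [z|z /andP[z0 _]].
    rewrite /f /f'; apply: is_derive_eq; rewrite /GRing.scale/=; by field.
  by apply: mulr_ge0; rewrite ?expR_ge0// subr_ge0 tanh_le.
rewrite /f oppr0 expr0n/= mul0r oppr0 expR0 lerN2 mulr1 => h.
by rewrite -[leRHS]mul1r -ler_pdivrMr ?expR_gt0// -expRN; lra.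
Qed.

(** Convexity of exp on the segment between - l r and l r. The tangent at l x lies below exp at both
    endpoints; averaging with weights (1 - x / r) / 2 and (1 + x / r) / 2 cancels the linear
    terms. *)
Lemma expR_chord l r x : 0 < r -> `|x| <= r ->
  expR (l * x) <= (expR (l * r) + expR (- (l * r))) / 2
    + (expR (l * r) - expR (- (l * r))) / (2 * r) * x.
Proof.
move=> r0; rewrite ler_norml => /andP[x_lo x_hi].
have tangent u : expR (l * x) * (1 + (u - l * x)) <= expR u.
  have -> : expR u = expR (l * x) * expR (u - l * x).
    by rewrite -expRD addrC subrK.
  by rewrite ler_wpM2l ?expR_ge0// expR_ge1Dx.
have r_neq0 : r != 0 by rewrite gt_eqF.
have := lerD (ler_wpM2l (_ : 0 <= (1 - x / r) / 2) (tangent (- (l * r))))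
  (ler_wpM2l (_ : 0 <= (1 + x / r) / 2) (tangent (l * r))).
have h : `|x / r| <= 1.
  by rewrite normrM normfV (gtr0_norm r0) ler_pdivrMr// mul1r ler_norml x_lo.
move: h; rewrite ler_norml => /andP[h1 h2] => /(_ _ _)/le_trans.
have -> : (1 - x / r) / 2 * (expR (l * x) * (1 + (- (l * r) - l * x))) +
  (1 + x / r) / 2 * (expR (l * x) * (1 + (l * r - l * x))) = expR (l * x) by field.
apply; [lra|lra|].
rewrite le_eqVlt; apply/orP; left; apply/eqP; field.
exact: r_neq0.
Qed.

End RealInequalities.
(** * Tail bounds for independent variables *)

Section DiscreteVariables.
Context {R : realType} {d : measure_display} {Omega : measurableType d}.
Variable P : probability Omega R.

Lemma probability_bigU (J : Type) (s : seq J) (Q : pred J) (F : J -> set Omega) :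
  (forall j, Q j -> measurable (F j)) ->
  (P (\big[setU/set0]_(j <- s | Q j) F j) <= \sum_(j <- s | Q j) P (F j))%E.
Proof.
move=> mF; elim: s => [|j s IH]; first by rewrite !big_nil measure0.
rewrite !big_cons; case: ifP => // Qj.
apply: (le_trans (measureU2 _ _ _)); [exact: mF|exact: bigsetU_measurable|].
exact: leeD2l.
Qed.

Definition discrete_measurable (X : Omega -> nat) :=
  forall A : set nat, measurable (X @^-1` A).

Lemma discrete_measurable_comp (f : nat -> R) (X : Omega -> nat) :
  discrete_measurable X -> measurable_fun setT (f \o X).
Proof. by move=> mX _ B mB; rewrite setTI; exact: (mX (f @^-1` B)). Qed.

Lemma probability_fin (A : set Omega) : measurable A -> P A = (fine (P A))%:E.
Proof. by move=> mA; rewrite fineK// fin_num_measure. Qed.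

Lemma fine_probability_ge0 (A : set Omega) : 0 <= fine (P A).
Proof. exact: fine_ge0. Qed.

Definition nat_pmf (X : Omega -> nat) (k : nat) : R := fine (P (X @^-1` [set k])).

Lemma expectation_bounded_nat (X : Omega -> nat) (M : nat) (f : nat -> R) :
  discrete_measurable X -> (forall w, (X w <= M)%N) -> (forall k, 0 <= f k) ->
  ('E_P[f \o X] = (\sum_(k < M.+1) nat_pmf X k * f k)%:E)%E.
Proof.
move=> mX Xle f0; rewrite unlock.
under eq_integral => w _.
  (* As [X] takes finitely many values, [f \o X] is a finite combination of indicators of its
     fibers. *)
  rewrite [((f \o X) w)%:E](_ : _ =
    (\sum_(k < M.+1) (f k * \1_(X @^-1` [set (k : nat)]) w)%:E)%E).
    over.
  rewrite sumEFin; congr (_%:E) => /=.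
  rewrite (bigD1 (Ordinal (Xle w : (X w < M.+1)%N)))//= indicE mem_set//= mulr1.
  rewrite big1 ?addr0// => k kX; rewrite indicE memNset ?mulr0//= => Xk.
  by move/eqP: kX; apply; apply/val_inj.
rewrite ge0_integral_sum//.
- rewrite -sumEFin; apply: eq_bigr => k _.
  have mk : measurable (X @^-1` [set k : nat]) by exact: mX.
  under eq_integral do rewrite EFinM.
  rewrite ge0_integralZl//.
  + by rewrite integral_indic// setIT /nat_pmf mulrC EFinM -probability_fin.
  + by apply/measurable_EFinP; exact: measurable_indic.
  + by rewrite lee_fin.
- by move=> k; apply/measurable_EFinP; apply: measurable_funM.
- by move=> k w _; rewrite lee_fin mulr_ge0.
Qed.

Lemma sum_nat_pmf (X : Omega -> nat) (M : nat) :
  discrete_measurable X -> (forall w, (X w <= M)%N) ->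
  \sum_(k < M.+1) nat_pmf X k = 1.
Proof.
move=> mX Xle; apply: EFin_inj.
rewrite -(expectation_cst P 1) -[cst 1]/(cst 1 \o X).
rewrite (expectation_bounded_nat mX Xle)//.
by congr (_%:E); apply: eq_bigr => k _; rewrite mulr1.
Qed.

(** * Finite families of independent integer variables *)

Section Family.
Variables (I : finType) (X : I -> Omega -> nat).
Hypothesis mX : forall i, discrete_measurable (X i).

(** Such an event is a union of fibers of the joint vector, which has countably many values.
    Measurability of every event below is obtained in this way. *)
Lemma measurable_determined (A : set Omega) :
  (forall w w', (forall i, X i w = X i w') -> A w -> A w') -> measurable A.
Proof.
move=> detA.
pose F (y : {ffun I -> nat}) : set Omega :=
  if `[< exists2 w, A w & forall i, X i w = y i >] then
    \bigcap_(i in [set: I]) X i @^-1` [set y i] else set0.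
suff -> : A = \bigcup_y F y.
  apply: countable_bigcupT_measurable => [|y]; first exact: countableP.
  rewrite /F; case: ifP => // _; apply: fin_bigcap_measurable => // i _.
  exact: mX.
apply/seteqP; split => [w Aw|w [y _]].
  exists [ffun i => X i w] => //; rewrite /F ifT.
    by move=> i _ /=; rewrite ffunE.
  by apply/asboolP; exists w => // i; rewrite ffunE.
rewrite /F; case: ifP => // /asboolP[w' Aw' w'y] yw; apply: (detA w') => // i.
by rewrite w'y yw.
Qed.

Hypothesis indepX : mutually_independent P X.

Lemma mutually_independent_comp (g : I -> nat -> nat) :
  mutually_independent P (fun i => g i \o X i).
Proof. by move=> J A; exact: (indepX J (fun i => g i @^-1` A i)). Qed.

Variables (M : nat) (a : I -> nat -> R).
Hypothesis X_le : forall i w, (X i w <= M)%N.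

(* The event is a finite union of the fibers of [X], whose probabilities are
   products by independence; the exponential bound is then summed over all
   value vectors, and distributivity factors the sum. *)
Lemma chernoff_product (l c : R) : 0 <= l ->
  (P [set w | (c <= \sum_i a i (X i w))%R] <=
   (expR (- (l * c)) *
    \prod_i \sum_(k < M.+1) nat_pmf (X i) k * expR (l * a i k))%:E)%E.
Proof.
move=> l0.
pose fiber (y : {ffun I -> 'I_M.+1}) : set Omega :=
  \bigcap_(i in [set` [set: I]%SET]) X i @^-1` [set (y i : nat)].
have mfiber y : measurable (fiber y).
  by apply: fin_bigcap_measurable => // i _; exact: mX.
pose A := [set w | c <= \sum_i a i (X i w)].
pose Q (y : {ffun I -> 'I_M.+1}) := c <= \sum_i a i (y i).
have mA : measurable A.
  apply: measurable_determined => w w' ww'; rewrite /A/= => /le_trans; apply.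
  by rewrite le_eqVlt; apply/orP; left; apply/eqP/eq_bigr => i _; rewrite ww'.
have AU : A `<=` \big[setU/set0]_(y | Q y) fiber y.
  move=> w Aw; pose y : {ffun I -> 'I_M.+1} := [ffun i => inord (X i w)].
  have yE i : y i = X i w :> nat by rewrite ffunE inordK// ltnS.
  have Qy : Q y by rewrite /Q; under eq_bigr do rewrite yE.
  by rewrite (bigD1 y)//=; left => i _ /=; rewrite yE.
apply: (@le_trans _ _ (P (\big[setU/set0]_(y | Q y) fiber y))).
  by apply: le_measure => //; rewrite inE//; exact: bigsetU_measurable.
apply: (le_trans (probability_bigU _ _)) => //.
have Pfiber y : P (fiber y) = (\prod_i nat_pmf (X i) (y i))%:E.
  rewrite /fiber indepX -prodEFin; apply: eq_big => [i|i _]; first by rewrite inE.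
  by rewrite -probability_fin//; exact: mX.
rewrite (eq_bigr _ (fun y _ => Pfiber y)).
rewrite sumEFin lee_fin bigA_distr_bigA/= mulr_sumr.
(* Value vectors outside [Q] only add nonnegative terms; on [Q] the weight exp (l (sum of the a_i -
   c)) is at least 1. *)
rewrite [leRHS](bigID Q)/= -[leLHS]addr0 lerD//.
  apply: ler_sum => y Qy; rewrite big_split/= -expR_sum -mulr_sumr.
  rewrite mulrCA -expRD ler_peMr ?prodr_ge0// => [i _|].
    exact: fine_probability_ge0.
  by rewrite -expR0 ler_expR addrC -mulrBr mulr_ge0// subr_ge0.
apply: sumr_ge0 => y _; rewrite mulr_ge0 ?expR_ge0// prodr_ge0// => i _.
by rewrite mulr_ge0 ?expR_ge0// fine_probability_ge0.
Qed.

End Family.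

Lemma le_probability_ae (A B : set Omega) : measurable A -> measurable B ->
  {ae P, forall w, A w -> B w} -> (P A <= P B)%E.
Proof.
move=> mA mB [N [mN N0 AB]].
apply: (@le_trans _ _ (P (B `|` N))).
  rewrite le_measure ?inE//; first exact: measurableU.
  move=> w Aw; have [Bw|nBw] := pselect (B w); [by left|right].
  by apply: AB => /= /(_ Aw).
have PN0 : P N = 0%E by [].
have PU : (P (B `|` N) <= P B + P N)%E by exact: measureU2.
by rewrite (le_trans PU)// PN0 adde0.
Qed.

(** A value violating [Q] has a null fiber. Almost sure bounds thus become pointwise bounds on the
    atoms. *)
Lemma nat_pmf_neq0_ae (X : Omega -> nat) (Q : nat -> Prop) (k : nat) :
  discrete_measurable X -> {ae P, forall w, Q (X w)} -> nat_pmf X k != 0 -> Q k.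
Proof.
move=> mX QX; apply: contra_neqP => nQk.
have mk : measurable (X @^-1` [set k]) by exact: mX.
have : (P (X @^-1` [set k]) <= P set0)%E.
  apply: le_probability_ae => //.
  by apply: filterS QX => w + /= Xk; rewrite Xk.
by rewrite measure0 measure_le0 => /eqP; rewrite /nat_pmf => ->.
Qed.

Lemma ae_le_truncn (X : Omega -> nat) (m r : R) :
  {ae P, forall w, `|(X w)%:R - m| <= r} ->
  {ae P, forall w, (X w <= Num.truncn (m + r))%N}.
Proof.
apply: filterS => w; rewrite ler_norml => /andP[_ Xw].
have mr0 : 0 <= m + r by apply: le_trans (_ : (X w)%:R <= _) => //; lra.
by rewrite truncn_ge_nat//; lra.
Qed.

(** Truncating at [M] changes [X] only on a null set. The truncation supplies the everywhere bound
    that [chernoff_product] requires, while arrivals are bounded only almost surely. *)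
Lemma expectation_ae_bounded_nat (X : Omega -> nat) (M : nat) :
  discrete_measurable X -> {ae P, forall w, (X w <= M)%N} ->
  ('E_P[fun w => (X w)%:R : R] =
   (\sum_(k < M.+1) nat_pmf (fun w => minn (X w) M) k * k%:R)%:E)%E.
Proof.
move=> mX XM.
have mZ : discrete_measurable (fun w => minn (X w) M).
  by move=> A; exact: (mX ((fun k => minn k M) @^-1` A)).
rewrite -(@expectation_bounded_nat _ _ (fun k => k%:R))//; last first.
  by move=> w; rewrite geq_minr.
rewrite unlock; apply: ge0_ae_eq_integral => //.
- by apply/measurable_EFinP; exact: (discrete_measurable_comp (fun k => k%:R)).
- by apply/measurable_EFinP; exact: (discrete_measurable_comp (fun k => k%:R) mZ).
- by move=> w _; rewrite lee_fin.
- by apply: filterS XM => w Xw _ /=; rewrite (minn_idPl Xw).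
Qed.

(** Hoeffding's lemma for the range [m - r, m + r]: after replacing exp by its chord, the linear
    term has mean zero, and what remains is cosh (l r). *)
Lemma hoeffding_factor (X : Omega -> nat) (M : nat) (m l r : R) :
  discrete_measurable X -> (forall w, (X w <= M)%N) ->
  m = \sum_(k < M.+1) nat_pmf X k * k%:R -> 0 < r ->
  (forall k, nat_pmf X k != 0 -> `|k%:R - m| <= r) ->
  \sum_(k < M.+1) nat_pmf X k * expR (l * (k%:R - m)) <= expR (l ^+ 2 * r ^+ 2 / 2).
Proof.
move=> mX XM mE r0 Xr.
have h (k : 'I_M.+1) : nat_pmf X k * expR (l * (k%:R - m)) <=
    nat_pmf X k * ((expR (l * r) + expR (- (l * r))) / 2)
    + (expR (l * r) - expR (- (l * r))) / (2 * r) * (nat_pmf X k * k%:R)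
    - (expR (l * r) - expR (- (l * r))) / (2 * r) * m * nat_pmf X k.
  have [->|/Xr km] := eqVneq (nat_pmf X k) 0; first by rewrite !(mul0r, mulr0) addr0 subr0.
  have := ler_wpM2l (fine_probability_ge0 (X @^-1` [set (k : nat)])) (expR_chord l r0 km).
  rewrite -/(nat_pmf X k) => /le_trans; apply.
  by rewrite le_eqVlt; apply/orP; left; apply/eqP; ring.
apply: (le_trans (ler_sum _ (fun k _ => h k))).
rewrite sumrB big_split/= -!mulr_suml -!mulr_sumr -mE sum_nat_pmf// mulr1 mul1r.
by rewrite addrK -exprMn; exact: cosh_le.
Qed.

(** * Hoeffding and Chernoff bounds *)

Section Tails.
Variables (I : finType) (X : I -> Omega -> nat).
Hypothesis mX : forall i, discrete_measurable (X i).
Hypothesis indepX : mutually_independent P X.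

(** The sign [s] covers the upper and the lower tail at once. *)
Lemma hoeffding (J : pred I) (m : I -> R) (s r c : R) :
  s ^+ 2 = 1 -> 0 < r -> 0 < c ->
  (forall i, J i -> {ae P, forall w, `|(X i w)%:R - m i| <= r}) ->
  (forall i, J i -> m i = fine 'E_P[fun w => (X i w)%:R : R]) ->
  (P [set w | (c <= s * \sum_(i | J i) ((X i w)%:R - m i))%R] <=
   (expR (- (c ^+ 2 / (2 * #|J|%:R * r ^+ 2))))%:E)%E.
Proof.
move=> s2 r0 c0 Xr mE.
have [M XM] : exists M, forall i, J i -> {ae P, forall w, (X i w <= M)%N}.
  exists (\max_i Num.truncn (m i + r)) => i Ji.
  apply: filterS (ae_le_truncn (Xr i Ji)) => w /leq_trans; apply.
  exact: leq_bigmax.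
(* For empty [J] the exponent is a quotient by zero, hence 0 by convention, and the bound is 1. *)
have [J0|J0] := posnP #|J|.
  rewrite J0 mulr0 mul0r invr0 mulr0 oppr0 expR0; apply: probability_le1.
  by apply: (measurable_determined mX) => w w' ww' /=; under eq_bigr do rewrite ww'.
(* Coordinates outside [J] are erased and the others truncated, so that all variables are bounded by
   [M] everywhere; independence survives. *)
pose g i k := if J i then minn k M else 0%N.
pose Z i := g i \o X i.
pose a i (k : nat) : R := if J i then s * (k%:R - m i) else 0.
have mZ i : discrete_measurable (Z i) by move=> A; exact: (mX i (g i @^-1` A)).
have ZM i w : (Z i w <= M)%N by rewrite /Z /g/=; case: ifP => // _; exact: geq_minr.
have n0 : 0 < #|J|%:R :> R by rewrite ltr0n.
have r20 : 0 < r ^+ 2 by rewrite exprn_gt0.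
(* This [l] minimises - l c + n l^2 r^2 / 2, where n is the size of [J]; the minimum is the claimed
   exponent. *)
pose l := c / (#|J|%:R * r ^+ 2).
have l0 : 0 <= l by rewrite divr_ge0 ?mulr_ge0 ?ltW.
apply: (@le_trans _ _ (P [set w | (c <= \sum_i a i (Z i w))%R])).
  apply: le_probability_ae.
  - apply: (measurable_determined mX) => w w' ww' /=.
    by under [in X in X -> _]eq_bigr do rewrite ww'.
  - apply: (measurable_determined mZ) => w w' ww' /=.
    by under [in X in X -> _]eq_bigr do rewrite ww'.
  - have : {ae P, forall w, forall i, J i -> (X i w <= M)%N}.
      by apply: filter_forall => i; case: (boolP (J i)) => [/XM|_];
        [apply: filterS|exact: aeW].
    apply: filterS => w Xw /le_trans; apply.
    rewrite le_eqVlt; apply/orP; left; apply/eqP.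
    rewrite big_mkcond mulr_sumr; apply: eq_bigr => i _.
    rewrite /a /Z /g/=; case: ifPn => [Ji|_]; last by rewrite mulr0.
    by rewrite (minn_idPl _)// Xw.
apply: (le_trans (chernoff_product mZ (mutually_independent_comp indepX g) a ZM c l0)).
rewrite lee_fin.
have -> : - (c ^+ 2 / (2 * #|J|%:R * r ^+ 2)) =
    - (l * c) + \sum_(i | J i) (l ^+ 2 * r ^+ 2 / 2).
  rewrite sumr_const -mulr_natr /l; field.
  by rewrite !gt_eqF.
rewrite expRD ler_wpM2l ?expR_ge0// expR_sum [leRHS]big_mkcond/=.
apply: ler_prod => i _; rewrite sumr_ge0/= => [|k _]; last first.
  by rewrite mulr_ge0 ?expR_ge0// fine_probability_ge0.
rewrite /a; case: ifPn => [Ji|nJi]; last first.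
  by under eq_bigr do rewrite mulr0 expR0 mulr1; rewrite sum_nat_pmf.
under eq_bigr do rewrite mulrA.
have -> : l ^+ 2 * r ^+ 2 / 2 = (l * s) ^+ 2 * r ^+ 2 / 2.
  by rewrite [(l * s) ^+ 2]exprMn s2 mulr1.
have ZE : Z i = (fun w => minn (X i w) M) by apply/funext => w; rewrite /Z /g/= Ji.
apply: hoeffding_factor => //.
  by rewrite mE// (expectation_ae_bounded_nat (mX i) (XM i Ji))/= ZE.
have Zr : {ae P, forall w, `|(Z i w)%:R - m i| <= r}.
  apply: filterS2 (Xr i Ji) (XM i Ji) => w Xw XwM.
  by rewrite ZE (minn_idPl XwM).
by move=> k; apply: (nat_pmf_neq0_ae (Q := fun k => `|k%:R - m i| <= r) (mZ i) Zr).
Qed.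

Lemma chernoff_count (J : pred I) (S : I -> pred nat) (e c : R) :
  e = \sum_(i | J i) fine (P [set w | S i (X i w)]) -> 0 < c ->
  (P [set w | (e + c <= \sum_(i | J i) (S i (X i w))%:R)%R] <=
   (expR (- (c ^+ 2 / (2 * e + c))))%:E)%E.
Proof.
move=> eE c0.
have e0 : 0 <= e by rewrite eE sumr_ge0// => i _; exact: fine_probability_ge0.
pose g i k : nat := J i && S i k.
pose Z i := g i \o X i.
(* For this [l], [expR_le_div] gives e * expR l <= e + c, and the exponent
   e * (expR l - 1) - l * (e + c) is at most - c^2 / (2 e + c), even if e = 0. *)
pose l := 2 * c / (2 * e + c).
have d0 : 0 < 2 * e + c by lra.
have l0 : 0 <= l by rewrite divr_ge0// ltW//; lra.
have mZ i : discrete_measurable (Z i) by move=> A; exact: (mX i (g i @^-1` A)).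
have ZM i w : (Z i w <= 1)%N by exact: leq_b1.
have -> : [set w | (e + c <= \sum_(i | J i) (S i (X i w))%:R)%R] =
    [set w | (e + c <= \sum_i (Z i w)%:R)%R].
  apply/funext => w /=; rewrite big_mkcond/=; congr (is_true (_ <= _)).
  by apply: eq_bigr => i _; rewrite /Z /g/=; case: (J i).
apply: (le_trans (chernoff_product mZ (mutually_independent_comp indepX g)
  (fun _ k => k%:R) ZM (e + c) l0)).
rewrite lee_fin.
have elc : e * expR l <= e + c.
  have [->|e_neq0] := eqVneq e 0; first by rewrite mul0r; lra.
  have e_gt0 : 0 < e by rewrite lt0r e_neq0.
  have := expR_le_div l0.
  have -> : 2 - l = 4 * e / (2 * e + c) by rewrite /l; field; rewrite gt_eqF.
  have -> : 2 + l = 4 * (e + c) / (2 * e + c) by rewrite /l; field; rewrite gt_eqF.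
  rewrite [leLHS]mulrA ler_pM2r ?invr_gt0//; lra.
apply: (@le_trans _ _ (expR (- (l * (e + c)) + e * (expR l - 1)))); last first.
  rewrite ler_expR; apply: (@le_trans _ _ (- (l * (e + c)) + c)); first lra.
  rewrite le_eqVlt; apply/orP; left; apply/eqP; rewrite /l; field.
  by rewrite gt_eqF.
rewrite expRD ler_wpM2l ?expR_ge0// [in leRHS]eE mulr_suml expR_sum [leRHS]big_mkcond/=.
apply: ler_prod => i _; rewrite sumr_ge0/= => [|k _]; last first.
  by rewrite mulr_ge0 ?expR_ge0// fine_probability_ge0.
have := sum_nat_pmf (mZ i) (ZM i); rewrite !big_ord_recl !big_ord0/= /bump/= !addr0.
rewrite mulr0 expR0 !mulr1 => /(canRL (addrK _)) ->.
have -> : nat_pmf (Z i) 1 = if J i then fine (P [set w | S i (X i w)]) else 0.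
  rewrite /nat_pmf /Z /g/=; case: (J i) => /=.
    by congr (fine (P _)); apply/funext => w /=; apply/propext; case: (S i _).
  rewrite (_ : _ @^-1` _ = set0) ?measure0//.
  by apply/seteqP; split => w.
case: ifP => _; last by rewrite subr0 mul0r addr0.
(* A Bernoulli variable of parameter p contributes 1 + p (exp l - 1), at most exp (p (exp l -
   1)). *)
by apply: le_trans (expR_ge1Dx _); lra.
Qed.

End Tails.
End DiscreteVariables.

(** * Deterministic analysis of the algorithm *)

(** Induction on [m]: by injectivity at most one unit has rank [m], and it receives what is left of
    [A] after the lower ranks, capped below by 0 and above by its own size. *)
Lemma greedy_fill (R : realDomainType) (B : finType) (rk : B -> nat)
    (u : B -> R) (A : R) (m : nat) :
  injective rk -> (forall b, 0 <= u b) -> 0 <= A ->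
  \sum_(b | (rk b < m)%N)
    Num.min (u b) (Num.max 0 (A - \sum_(b' | (rk b' < rk b)%N) u b')) =
  Num.min A (\sum_(b | (rk b < m)%N) u b).
Proof.
move=> rk_inj u0 A0; elim: m => [|m IH].
  by rewrite !big_pred0//; apply/esym/min_idPr.
have split_m (F : B -> R) : \sum_(b | (rk b < m.+1)%N) F b =
    \sum_(b | (rk b < m)%N) F b + \sum_(b | rk b == m) F b.
  rewrite (bigID (fun b => rk b < m)%N)/=; congr (_ + _); apply: eq_bigl => b; lia.
rewrite !split_m IH.
have [b0 /eqP rkb0|rk_neq] := pickP (fun b => rk b == m); last first.
  have nil (F : B -> R) : \sum_(b | rk b == m) F b = 0 by exact: big_pred0.
  by rewrite !nil !addr0.
have eq_b0 b : (rk b == m) = (b == b0) by rewrite -rkb0 (inj_eq rk_inj).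
rewrite !(eq_bigl _ _ eq_b0) !big_pred1_eq rkb0.
set S := \sum_(b | _) _; have := u0 b0; move: (u b0) => v v0.
have [AS|SA] := leP A S.
  rewrite (max_idPl _) ?subr_le0// (min_idPr v0) addr0 (min_idPl _)//.
  by rewrite (le_trans AS)// lerDl.
rewrite (max_idPr _) ?subr_ge0 ?(ltW SA)//.
have [vAS|ASv] := leP v (A - S); first by rewrite (min_idPr _)//; lra.
by rewrite (min_idPl _); lra.
Qed.

(** The empty window. In particular [N_low_lt] vanishes at round 1. *)
Lemma N_low_nil (R : realType) (T : nat) (I : instance R T) (delta : R) (t : nat) :
  N_low I delta t.+1 t = 0.
Proof.
rewrite /N_low /confN subnn mulr0 !mul0r sqrtr0 subr0.
rewrite /exp_int (_ : arr_int t.+1 t = cst 0) ?expectation_cst//.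
by apply/funext => w'; rewrite /arr_int big_geq.
Qed.

Section Guardrail.
Variables (R : realType) (T : nat) (I : instance R T) (delta L : R) (w : Omega I).

Local Notation rem t := (state delta L w t).2.
Local Notation Xl := (X_low I delta).
Local Notation B t := (budget delta L t w).

Definition alloc (t : nat) : R :=
  \sum_(theta : types I) arr t theta w * guardrail delta L t w (B t).
(** The parts available between the allocation and the spoilage of round [t]; in the state after
    round [t] the spoiled units are already set to 0. *)
Definition leftover (t : nat) : 'I_(nunits I) -> R := hand_out (rem t.-1) (alloc t).
Definition pua (t : nat) : R := \sum_(b | perish b w == t) leftover t b.
(** The negation of the first test of [guardrail]: the budget affords [X_low] per individual. *)
Definition good (t : nat) : bool := arr_tot t w * Xl <= B t.

Lemma arr_tot_ge0 t : 0 <= arr_tot t w.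
Proof. by rewrite sumr_ge0. Qed.

Lemma rank_inj : injective (@rank R T I).
Proof. by move=> b b' [] /val_inj /perm_inj. Qed.

Lemma allocE t : alloc t = arr_tot t w * guardrail delta L t w (B t).
Proof. by rewrite /alloc -mulr_suml. Qed.

Lemma budgetS t : B t.+2 = B t.+1 - alloc t.+1 - pua t.+1.
Proof. by rewrite /pua /leftover /alloc /budget/=; case: (state _ _ _ _). Qed.

Lemma remS t b : rem t.+1 b = if (perish b w <= t.+1)%N then 0 else leftover t.+1 b.
Proof. by rewrite /leftover /alloc /budget/=; case: (state _ _ _ _). Qed.

Lemma hand_out_itv (u : 'I_(nunits I) -> R) (A : R) b :
  0 <= u b -> 0 <= hand_out u A b <= u b.
Proof.
move=> u0; rewrite /hand_out subr_ge0 ge_min lexx/= lerBlDr lerDl.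
by rewrite le_min u0 le_max lexx.
Qed.

Lemma rem_itv t b : 0 <= rem t b <= 1.
Proof.
elim: t b => [|t IH] b; first by rewrite /= ler01 lexx.
rewrite remS; case: ifP => _; first by rewrite lexx ler01.
have /andP[r0 r1] := IH b.
by have /andP[-> /le_trans -> //] := hand_out_itv (alloc t.+1) r0.
Qed.

Lemma leftover_itv t b : 0 <= leftover t b <= 1.
Proof.
have /andP[r0 r1] := rem_itv t.-1 b.
by have /andP[-> /le_trans -> //] := hand_out_itv (alloc t) r0.
Qed.

(* While a unit is available, everything allocated so far comes from units of at
   most its rank. *)
Lemma leftover_cumulative_alloc t b :
  (forall s, (1 <= s <= t)%N -> 0 <= alloc s) -> (1 <= t)%N -> 0 < leftover t b ->
  \sum_(1 <= s < t.+1) alloc s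
    + \sum_(b' | (rank b' < (rank b).+1)%N) leftover t b' <= (rank b)%:R.
Proof.
move=> alloc0 t1.
have step (u : 'I_(nunits I) -> R) (A C : R) : (forall b', 0 <= u b') -> 0 <= A ->
    (0 < u b -> C + \sum_(b' | (rank b' < (rank b).+1)%N) u b' <= (rank b)%:R) ->
    0 < hand_out u A b ->
    C + A + \sum_(b' | (rank b' < (rank b).+1)%N) hand_out u A b' <= (rank b)%:R.
  move=> u0 A0 Cu hb.
  have ub : 0 < u b.
    by have /andP[_] := hand_out_itv A (u0 b); exact: lt_le_trans.
  rewrite sumrB greedy_fill//; last exact: rank_inj.
  (* Since part of [b] survives, [A] is exhausted by the units of rank at most that of [b]: the
     amount moves from their remaining parts to the cumulative allocation. *)
  have AS : A <= \sum_(b' | (rank b' < (rank b).+1)%N) u b'.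
    move: hb; rewrite /hand_out subr_gt0 gt_min ltxx/= gt_max => /andP[_ Ab].
    rewrite (bigD1 b)//= (eq_bigl (fun b' => rank b' < rank b)%N); first by lra.
    by move=> b'; rewrite ltnS -(inj_eq rank_inj); lia.
  by rewrite (min_idPl AS); have := Cu ub; lra.
elim: t alloc0 t1 => // t IH alloc0 _.
rewrite big_nat_recr//=; apply: step.
- by move=> b'; have /andP[] := rem_itv t b'.
- by apply: alloc0; rewrite leqnn.
(* Before round 1 all units are whole, and ranks are distinct and start at 1, so at most [rank b]
   units have rank at most [rank b]. *)
case: t IH alloc0 => [_ _ _|t IH alloc0].
  rewrite big_geq// add0r sumr_const/= ler_nat.
  rewrite cardE -(size_map (@rank R T I)) -[leqRHS](size_iota 1).
  apply: uniq_leq_size; first by rewrite map_inj_uniq ?enum_uniq//; exact: rank_inj.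
  by move=> _ /mapP[b' + ->]; rewrite mem_enum mem_iota.
rewrite remS; case: ifP => _; first by rewrite ltxx.
have alloc0' s : (1 <= s <= t.+1)%N -> 0 <= alloc s.
  by move=> /andP[s1 st]; apply: alloc0; rewrite s1 ltnW.
move=> lb; apply: le_trans (IH alloc0' isT lb).
rewrite lerD2l; apply: ler_sum => b' _; rewrite remS; case: ifP => // _.
by have /andP[] := leftover_itv t.+1 b'.
Qed.

Lemma leftover_lt_rank t b :
  (forall s, (1 <= s <= t)%N -> 0 <= alloc s) -> (1 <= t)%N -> 0 < leftover t b ->
  \sum_(1 <= s < t.+1) alloc s < (rank b)%:R.
Proof.
move=> alloc0 t1 lb; apply: lt_le_trans (leftover_cumulative_alloc alloc0 t1 lb).
rewrite ltrDl (bigD1 b)//= ltr_wpDr// sumr_ge0// => b' _.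
by have /andP[] := leftover_itv t b'.
Qed.

(** The event defining [prob_perish] at [X_low], as a condition on the perishing time alone; [eta t]
    is thus the mean number of units at risk among those passing the rank filter. *)
Definition at_risk (t : nat) (b : 'I_(nunits I)) (k : nat) : Prop :=
  (t <= k)%N /\ ((k%:R : R)%:E < mine (T%:R)%:E (tau delta b t Xl))%E.

Lemma pua_ge0 t : 0 <= pua t.
Proof. by rewrite sumr_ge0// => b _; have /andP[] := leftover_itv t b. Qed.

(** A unit spoils only in the round of its perishing time, and loses at most its size 1. *)
Lemma sum_pua t t' : \sum_(t <= s < t'.+1) pua s <=
  \sum_b ((t <= perish b w < t'.+1)%N && (0 < leftover (perish b w) b))%:R.
Proof.
rewrite /pua; under eq_bigr do rewrite big_mkcond.
rewrite exchange_big/=; apply: ler_sum => b _.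
rewrite -big_mkcond/=; under eq_bigl do rewrite eq_sym.
rewrite big_nat1_eq; case: ifP => //= _.
have /andP[l0 l1] := leftover_itv (perish b w) b.
by case: ltP => // ?; exact: le_trans l1 _.
Qed.

(** * Behaviour of the guardrail within the confidence bounds *)

Hypothesis lowN : forall t t', (1 <= t <= t'.+1)%N -> (t' <= T)%N ->
  N_low I delta t t' <= arr_int t t' w.
Hypothesis upN : forall t, (t < T)%N -> arr_int t.+1 T w <= N_up_gt I delta t.
Hypothesis perish_le : forall t, (1 <= t <= T)%N ->
  \sum_(b | Num.ceil (N_low_lt I delta t * Xl) <= (rank b)%:Z)
     `[< at_risk t b (perish b w) >]%:R
  <= eta I delta t + confP T delta t (eta I delta t).
Hypothesis Xl_ge0 : 0 <= Xl.
Hypothesis L_ge0 : 0 <= L.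

Lemma guardrail_good t : good t ->
  guardrail delta L t w (B t) =
    (if Xl * N_up_gt I delta t + P_up I delta t <= B t - arr_tot t w * X_up I delta L
     then X_up I delta L else Xl).
Proof. by rewrite /good /guardrail leNgt => /negbTE ->. Qed.

Lemma alloc_good t : good t -> arr_tot t w * Xl <= alloc t.
Proof.
move=> gt; rewrite allocE guardrail_good// ler_wpM2l ?arr_tot_ge0//.
by case: ifP => // _; rewrite /X_up lerDl.
Qed.

Lemma alloc_good_ge0 t : good t -> 0 <= alloc t.
Proof. by move=> /alloc_good; apply: le_trans; rewrite mulr_ge0 ?arr_tot_ge0. Qed.

Lemma arr_int_alloc t : (forall s, (1 <= s <= t)%N -> good s) ->
  arr_int 1 t w * Xl <= \sum_(1 <= s < t.+1) alloc s.
Proof.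
move=> gt; rewrite /arr_int mulr_suml.
by rewrite !big_seq ler_sum// => s; rewrite mem_index_iota => /gt /alloc_good.
Qed.

Lemma arr_int_cat t t' t'' : (t <= t'.+1)%N -> (t' <= t'')%N ->
  arr_int t t'' w = arr_int t t' w + arr_int t'.+1 t'' w.
Proof. by move=> tt' t't''; rewrite /arr_int -big_cat_nat. Qed.

(** If something of [b] spoils in round k, the total handed out through k is below its rank,
    although good rounds hand out at least [X_low] per arrival. Hence N_{<= s} [X_low] is below the
    rank for every s <= k: s = t - 1 places [b] in the rank filter, and s >= t keeps [tau] above
    k. *)
Lemma spoiled_at_risk t t' b :
  (1 <= t)%N -> (t' < T)%N -> (forall s, (1 <= s <= t')%N -> good s) ->
  (t <= perish b w < t'.+1)%N -> 0 < leftover (perish b w) b ->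
  Num.ceil (N_low_lt I delta t * Xl) <= (rank b)%:Z /\ at_risk t b (perish b w).
Proof.
set k := perish b w => t1 t'T gt /andP[tk kt'] lb.
have k1 : (1 <= k)%N by exact: leq_trans t1 tk.
have gk s : (1 <= s <= k)%N -> good s.
  by move=> /andP[s1 sk]; apply: gt; rewrite s1 (leq_trans sk).
have rank_gt s : (s <= k)%N -> arr_int 1 s w * Xl < (rank b)%:R.
  move=> sk; apply: le_lt_trans (leftover_lt_rank _ k1 lb); last first.
    by move=> ? /gk /alloc_good_ge0.
  apply: le_trans (arr_int_alloc gk).
  by rewrite ler_wpM2r// (@arr_int_cat 1 s k)// lerDl sumr_ge0// => ? _; exact: arr_tot_ge0.
have lowlt : N_low_lt I delta t <= arr_int 1 t.-1 w by apply: lowN; lia.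
split.
  rewrite ceil_le_int -pmulrn; apply: le_trans (ltW (rank_gt t.-1 _)); last lia.
  by rewrite ler_wpM2r.
split => //.
rewrite lt_min lte_fin ltr_nat (leq_trans kt' t'T)/=.
(* The infimum runs over integers, so it suffices that no admissible s is at most k. *)
apply: (@lt_le_trans _ _ (k.+1%:R)%:E); first by rewrite lte_fin ltr_nat.
apply/ereal_infP => _ [s [/andP[ts sT] rs] <-].
rewrite lee_fin ler_nat ltnNge; apply/negP => sk.
have := rank_gt s sk; rewrite ltNge => /negP; apply.
apply: (le_trans rs).
rewrite (@arr_int_cat 1 t.-1 s) ?prednK//; [|lia..].
rewrite -mulrDl ler_wpM2r// lerD// lowN//; lia.
Qed.

(** Induction along the running minimum [P_up]: the previous term already bounds spoilage over a
    longer window, and the new term bounds the number of units at risk. At 0 the bound is the number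
    of units. *)
Lemma sum_pua_P_up t t' : (t <= T)%N -> (t' < T)%N -> (forall s, (1 <= s <= t')%N -> good s) ->
  \sum_(t <= s < t'.+1) pua s <= P_up I delta t.
Proof.
move=> + t'T gt; elim: t => [_|t IH tT] /=.
  apply: (le_trans (sum_pua _ _)).
  apply: (@le_trans _ _ (\sum_(b : 'I_(nunits I)) 1)).
    by apply: ler_sum => b _; rewrite lern1 leq_b1.
  by rewrite sumr_const card_ord.
rewrite le_min; apply/andP; split.
  have := IH (ltnW tT); apply: le_trans.
  have [tt'|tt'] := ltnP t t'.+1; last first.
    by rewrite !big_geq ?(leqW tt').
  by rewrite [leRHS]big_ltn// lerDr pua_ge0.
apply: le_trans (perish_le _); last by rewrite ltnS leq0n.
apply: (le_trans (sum_pua _ _)).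
rewrite [leRHS]big_mkcond; apply: ler_sum => b _.
case: andP => [[tkt' lb]|_]; last by case: ifP.
have [-> /asboolP -> //] := spoiled_at_risk (ltn0Sn t) t'T gt tkt' lb.
Qed.

(** Reserve argument by induction on rounds. The invariant says that the budget plus everything
    spent and spoiled since round [s] covers the reserve made at [s]. The reserve exceeds the actual
    future arrivals times [X_low] and the actual spoilage, so [X_low] remains affordable. *)
Lemma good_round t : feasible I delta Xl -> 0 < N_up I delta ->
  (1 <= t <= T)%N -> good t.
Proof.
move=> [_ feas] Nup0.
pose rounds s t := Xl * arr_int s.+1 t.-1 w + \sum_(maxn 1 s <= u < t) pua u.
(* [s] is the last round before [t] in which X_up was allocated, or 0; in the
   latter case [P_up 1 = Delta_up X_low] bounds the perishing. *)
pose inv t := exists2 s, (s < t)%N &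
  Xl * N_up_gt I delta s + P_up I delta (maxn 1 s) <= B t + rounds s t.
have good_inv t' : (1 <= t' <= T)%N -> (forall s, (1 <= s < t')%N -> good s) ->
    inv t' -> good t'.
  move=> /andP[t1 tT] gt [s st]; rewrite /rounds /good => hs.
  have hP : \sum_(maxn 1 s <= u < t') pua u <= P_up I delta (maxn 1 s).
    rewrite -(prednK t1); apply: sum_pua_P_up; [lia|lia|] => u u1.
    by apply: gt; lia.
  have := upN (leq_trans st tT).
  rewrite (@arr_int_cat s.+1 t'.-1 T) ?prednK//; last by lia.
  have -> : arr_int t' T w = arr_tot t' w + arr_int t'.+1 T w.
    by rewrite /arr_int big_ltn.
  have N0 : 0 <= arr_int t'.+1 T w by rewrite sumr_ge0// => ? _; exact: arr_tot_ge0.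
  move: (N_up_gt _ _ _) hs => Nup hs.
  move=> /(ler_wpM2l Xl_ge0); rewrite !mulrDr [arr_tot t' w * _]mulrC.
  by have := mulr_ge0 Xl_ge0 N0; lra.
suff h : (1 <= t <= T)%N -> inv t /\ (forall s, (1 <= s < t)%N -> good s).
  by move=> tT; have [it gt] := h tT; exact: good_inv.
elim: t => // -[_ _|t IH tT].
  split; last by move=> s; lia.
  exists 0%N => //; rewrite /rounds maxn0 big_geq// /arr_int big_geq// mulr0 !addr0.
  have -> : P_up I delta 1 = Delta_up I delta Xl.
    (* At round 1 the rank threshold is 0 and every unit passes the filter. *)
    have etaE : eta I delta 1 = mu I delta Xl.
      apply: eq_bigl => b; rewrite /N_low_lt N_low_nil mul0r ceil0.
      by [].
    by rewrite /Delta_up -etaE.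
  (* Feasibility of [X_low], with the denominator cleared, is the initial reserve. *)
  by move: feas; rewrite ler_pdivlMr// -lerBrDr.
have [//|it gt] := IH _; first lia.
have gt1 : good t.+1 by apply: good_inv => //; lia.
split; last first.
  move=> s /andP[s1]; rewrite ltnS leq_eqVlt => /predU1P[->//|st].
  by apply: gt; rewrite s1.
rewrite /inv budgetS allocE guardrail_good//.
(* If [X_up] is given, the passed test is the invariant with [s] reset to this round; otherwise [s]
   is kept and the amount spent moves from the budget to [rounds]. *)
case: ifPn => [hi|lo].
  exists t.+1 => //; rewrite /rounds (maxn_idPr _)// big_nat1.
  by rewrite /arr_int big_geq// mulr0 add0r subrK.
have [s st hs] := it; exists s; first by lia.
move: hs; rewrite /rounds/= (@arr_int_cat s.+1 t t.+1) ?leqnSn//.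
have -> : arr_int t.+1 t.+1 w = arr_tot t.+1 w by rewrite /arr_int big_nat1.
rewrite (big_nat_recr t.+1)/= ?geq_max ?(ltnW st)//.
move: (N_up_gt _ _ _) => Nup; lra.
Qed.

End Guardrail.

(** * Concentration of arrivals and perishing *)

Section LogBounds.
Context {R : realType}.

(** From ln (1 + x) <= x at x = 1 / n - 1, which gives ln n >= 1 - 1 / n. *)
Lemma ln_nat_ge_half (n : nat) : (2 <= n)%N -> 2^-1 <= ln n%:R :> R.
Proof.
move=> n2; have n0 : 0 < n%:R :> R by rewrite ltr0n; lia.
have h : n%:R^-1 <= 2^-1 :> R by rewrite lef_pV2 ?posrE// ler_nat.
have := @le_ln1Dx R (n%:R^-1 - 1).
have -> : 1 + (n%:R^-1 - 1) = n%:R^-1 :> R by ring.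
rewrite lnV ?posrE//; have : 0 < n%:R^-1 :> R by rewrite invr_gt0.
by move=> i0 /(_ ltac:(lra)); lra.
Qed.

(** The harmonic sum is at most 1 + ln n, and 1 <= 2 ln n. This accounts for the 3 in [confP]: the
    failure probabilities delta / (3 t ln T) sum to at most delta. *)
Lemma harmonic_le_ln (n : nat) : (2 <= n)%N ->
  \sum_(k < n) k.+1%:R^-1 <= 3 * ln n%:R :> R.
Proof.
move=> n2; suff : \sum_(k < n) k.+1%:R^-1 <= 1 + ln n%:R :> R.
  by have := ln_nat_ge_half n2; lra.
elim: n n2 => // n IH; rewrite ltnS leq_eqVlt => /predU1P[<-|n1].
  rewrite !big_ord_recl big_ord0/= addr0 invr1 lerD2l.
  exact: ln_nat_ge_half.
have := IH n1; rewrite big_ord_recr/=.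
have n0 : 0 < n%:R :> R by rewrite ltr0n; lia.
have n0' : 0 < n.+1%:R :> R by rewrite ltr0n.
have := @le_ln1Dx R (- n.+1%:R^-1).
have -> : 1 - n.+1%:R^-1 = n%:R / n.+1%:R :> R.
  by rewrite -[in RHS]natr1; field; rewrite natr1 gt_eqF.
rewrite ln_div ?posrE// ltrN2 invf_lt1// ltr1n ltnW// => /(_ isT).
move: (n.+1%:R^-1) (ln _) (ln _) (\sum_(_ < _) _) => a b c d; lra.
Qed.

End LogBounds.

Section ConcentrationEvents.
Variables (R : realType) (T : nat) (I : instance R T) (delta : R).

Local Notation types := (types I).
Local Notation Omega := (Omega I).
Local Notation P := (Pr I).
Local Notation index := ('I_T * types + 'I_(nunits I))%type.

(** The jointly independent family of the instance; rounds are shifted by one because ['I_T] starts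
    at 0. *)
Definition source (i : index) : Omega -> nat :=
  match i with
  | inl p => arrivals p.1.+1 p.2
  | inr b => perish b
  end.

Lemma source_measurable i : discrete_measurable (source i).
Proof. by move=> A; case: i => [p|b] /=; exact: measurable_funPTI. Qed.

Lemma source_independent : mutually_independent P source.
Proof. exact: (@independence R T I). Qed.

Definition mean (t : nat) (theta : types) : R := fine 'E_P[arr t theta].

Lemma rho_le_max t (theta : types) : (1 <= t <= T)%N -> rho t theta <= rho_max I.
Proof.
move=> tT; rewrite /rho_max; apply: (bigmax_sup_seq _ t) => //.
  by rewrite mem_index_iota.
exact: le_bigmax.
Qed.

Lemma rho_max_ge0 : 0 <= rho_max I.
Proof. exact: bigmax_ge_id. Qed.

Lemma arr_dev_ae t (theta : types) : (1 <= t <= T)%N ->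
  {ae P, forall w, `|arr t theta w - mean t theta| <= rho_max I}.
Proof.
move=> tT; apply: filterS (arrivals_bound theta tT) => w /le_trans; apply.
exact: rho_le_max.
Qed.

(** Bounded deviations make the arrivals almost surely bounded, so the expectation is finite and
    [fine] loses nothing. *)
Lemma expectation_arr t (theta : types) : (1 <= t <= T)%N ->
  'E_P[arr t theta]%E = (mean t theta)%:E.
Proof.
move=> tT; rewrite /mean fineK//.
have mX : discrete_measurable (arrivals t theta).
  by move=> A; exact: measurable_funPTI.
by rewrite (expectation_ae_bounded_nat mX (ae_le_truncn (arrivals_bound theta tT))).
Qed.

Lemma measurable_arr t theta : measurable_fun setT (@arr R T I t theta).
Proof.
apply: (discrete_measurable_comp (fun k => k%:R)) => A.
exact: measurable_funPTI.
Qed.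

Lemma exp_intE t t' : (1 <= t)%N -> (t' <= T)%N ->
  exp_int I t t' = \sum_(t <= s < t'.+1) \sum_theta mean s theta.
Proof.
move=> t1 t'T; rewrite /exp_int unlock.
have mtot s : measurable_fun setT (@arr_tot R T I s).
  by apply: measurable_sum => theta; exact: measurable_arr.
under eq_integral do rewrite /arr_int -sumEFin.
rewrite ge0_integral_sum//; first last.
- by move=> s w _; rewrite lee_fin arr_tot_ge0.
- by move=> s; apply/measurable_EFinP.
rewrite (_ : (\sum_(_ <- _) _)%E =
  (\sum_(t <= s < t'.+1) \sum_theta mean s theta)%:E)//.
rewrite -sumEFin big_nat [RHS]big_nat; apply: eq_bigr => s /andP[ts st'].
under eq_integral do rewrite /arr_tot -sumEFin.
rewrite ge0_integral_sum//; first last.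
- by move=> theta w _; rewrite lee_fin.
- by move=> theta; apply/measurable_EFinP; exact: measurable_arr.
rewrite -sumEFin; apply: eq_bigr => theta _.
rewrite -expectation_arr ?unlock//; lia.
Qed.

Definition window (t t' : nat) (i : index) : bool :=
  if i is inl p then (t <= p.1.+1 <= t')%N else false.

Lemma sum_window (V : nmodType) (t t' : nat) (F : index -> V)
    (f : nat -> types -> V) :
  (1 <= t)%N -> (t' <= T)%N -> (forall p, F (inl p) = f p.1.+1 p.2) ->
  \sum_(i | window t t' i) F i = \sum_(t <= s < t'.+1) \sum_theta f s theta.
Proof.
move=> t1 t'T Ff; rewrite big_sumType/= [X in _ + X]big_pred0// addr0.
rewrite (eq_bigr _ (fun p _ => Ff p)).
rewrite (eq_bigl (fun p : 'I_T * types => (t <= p.1.+1 <= t')%N && true)); last first.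
  by move=> p; rewrite andbT.
rewrite -(pair_big_dep (fun k : 'I_T => (t <= k.+1 <= t')%N) (fun _ _ => true)
  (fun k theta => f k.+1 theta))/=.
rewrite -(big_mkord (fun k => (t <= k.+1 <= t')%N) (fun k => \sum_theta f k.+1 theta)).
rewrite -(big_add1 _ _ 0 T.+1 (fun k => (t <= k <= t')%N) (fun k => \sum_theta f k theta)).
rewrite [RHS](@big_nat_widen _ _ _ t _ T.+1)// [RHS](@big_nat_widenl _ _ _ t 1)//.
by apply: eq_bigl => k; rewrite /= ltnS andbC.
Qed.

Lemma arr_int_sub_exp t t' w : (1 <= t)%N -> (t' <= T)%N ->
  arr_int t t' w - exp_int I t t' = \sum_(i | window t t' i)
    ((source i w)%:R - if i is inl p then mean p.1.+1 p.2 else 0).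
Proof.
move=> t1 t'T; rewrite exp_intE// /arr_int -sumrB.
under eq_bigr do rewrite /arr_tot -sumrB.
by rewrite (@sum_window _ t t' _ (fun s theta => arr s theta w - mean s theta)).
Qed.

Lemma card_window t t' : (1 <= t)%N -> (t' <= T)%N ->
  #|window t t'| = ((t' - t.-1) * #|types|)%N.
Proof.
move=> t1 t'T; rewrite -sum1_card.
rewrite (@sum_window _ t t' _ (fun _ _ => 1%N))// sum_nat_const_nat sum1_card.
by congr (_ * _)%N; lia.
Qed.

Hypothesis delta01 : 0 < delta < 1.

(** [confN] is chosen so that the Hoeffding exponent equals ln (2 T^2 / delta). *)
Lemma arr_int_tail t t' (s : R) : (1 <= t <= t')%N -> (t' <= T)%N -> s ^+ 2 = 1 ->
  (P [set w | (confN I delta t.-1 t' < s * (arr_int t t' w - exp_int I t t'))%R] <=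
   (delta / (2 * T%:R ^+ 2))%:E)%E.
Proof.
move=> /andP[t1 tt'] t'T s2.
have /andP[d0 d1] := delta01.
have T0 : 0 < T%:R :> R by rewrite ltr0n; lia.
have T1 : 1 <= T%:R :> R by rewrite ler1n; lia.
have q0 : 0 < delta / (2 * T%:R ^+ 2) by rewrite divr_gt0// mulr_gt0// exprn_gt0.
pose A := [set w : Omega | (confN I delta t.-1 t' < s * (arr_int t t' w - exp_int I t t'))%R].
have mA : measurable A.
  apply: (measurable_determined source_measurable) => w w' ww'.
  rewrite /A/= !arr_int_sub_exp//.
  by under eq_bigr do rewrite ww'.
have dev_ae i : window t t' i ->
    {ae P, forall w, `|(source i w)%:R - (if i is inl p then mean p.1.+1 p.2 else 0)|
      <= rho_max I}.
  by case: i => // p _; apply: arr_dev_ae; rewrite ltn_ord.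
set n : R := #|window t t'|%:R.
set lg := ln (2 * T%:R ^+ 2 / delta).
have lg_gt0 : 0 < lg.
  rewrite ln_gt0// ltr_pdivlMr// mul1r (lt_le_trans d1)//.
  by have := @exprn_ege1 R 2 _ T1; lra.
have q_exp : delta / (2 * T%:R ^+ 2) = expR (- lg).
  by rewrite expRN lnK ?invf_div// posrE divr_gt0// mulr_gt0// exprn_gt0.
have confE : confN I delta t.-1 t' = Num.sqrt (2 * n * rho_max I ^+ 2 * lg).
  by rewrite /confN /n card_window// natrM (mulrA 2).
(* Degenerate case: the deviation is almost surely 0, and the event asks for a strict excess over a
   nonnegative number. *)
have [nr0|nr0] := eqVneq (n * rho_max I) 0.
  apply: (@le_trans _ _ (P set0)); last by rewrite measure0 lee_fin ltW.
  apply: le_probability_ae => //.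
  have : {ae P, forall w, forall i, window t t' i ->
    `|(source i w)%:R - (if i is inl p then mean p.1.+1 p.2 else 0)| <= rho_max I}.
    by apply: filter_forall => i; case: (boolP (window t t' i)) => [/dev_ae|_];
      [apply: filterS|exact: aeW].
  apply: filterS => w dev; rewrite /A/= arr_int_sub_exp// => Aw.
  have := lt_le_trans Aw (ler_norm _); rewrite normrM.
  have -> : `|s| = 1 by apply/eqP; rewrite -sqrp_eq1// -normrX s2 normr1.
  rewrite mul1r => /lt_le_trans/(_ (ler_norm_sum _ _ _)).
  move=> /lt_le_trans/(_ (ler_sum _ dev)); rewrite sumr_const -mulr_natl nr0.
  by rewrite ltNge sqrtr_ge0.
have [n0 r0] : n != 0 /\ rho_max I != 0 by apply/andP; rewrite -negb_or -mulf_eq0.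
have n_gt0 : 0 < n by rewrite lt0r n0 ler0n.
have r_gt0 : 0 < rho_max I by rewrite lt0r r0 rho_max_ge0.
have arg_gt0 : 0 < 2 * n * rho_max I ^+ 2 * lg.
  by rewrite mulr_gt0// mulr_gt0 ?exprn_gt0// mulr_gt0.
have conf_gt0 : 0 < confN I delta t.-1 t' by rewrite confE sqrtr_gt0.
apply: (@le_trans _ _ (P [set w | (confN I delta t.-1 t' <=
    s * \sum_(i | window t t' i)
    ((source i w)%:R - if i is inl p then mean p.1.+1 p.2 else 0))%R])).
  apply: le_measure; rewrite ?inE//.
    apply: (measurable_determined source_measurable) => w w' ww' /=.
    by under eq_bigr do rewrite ww'.
  by move=> w; rewrite /A/= arr_int_sub_exp// => /ltW.
apply: (le_trans (hoeffding source_measurable source_independent s2 r_gt0 conf_gt0 dev_ae _)).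
  by case.
rewrite lee_fin q_exp ler_expR lerN2 confE.
rewrite sqr_sqrtr ?(ltW arg_gt0)//.
rewrite le_eqVlt; apply/orP; left; apply/eqP; rewrite -/n; field.
by rewrite n0 r0.
Qed.

(** [chernoff_count] applied to the units at risk, whose mean number is [eta t]; with [confP] as
    deviation the exponent is exactly the logarithm in its definition. *)
Lemma perish_tail t : (2 <= T)%N -> (1 <= t <= T)%N ->
  (P [set w | (eta I delta t + confP T delta t (eta I delta t) <
     \sum_(b | Num.ceil (N_low_lt I delta t * X_low I delta) <= (rank b)%:Z)
     `[< at_risk delta t b (perish b w) >]%:R)%R] <=
   (delta / (3 * t%:R * ln T%:R))%:E)%E.
Proof.
move=> T2 /andP[t1 tT]; have /andP[d0 d1] := delta01.
have T0 : 0 < T%:R :> R by rewrite ltr0n; lia.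
have lnT : 2^-1 <= ln T%:R :> R by exact: ln_nat_ge_half.
have t1' : 1 <= t%:R :> R by rewrite ler1n.
set e := eta I delta t; set c := confP T delta t e.
pose Q (i : index) := if i is inr b then
  Num.ceil (N_low_lt I delta t * X_low I delta) <= (rank b)%:Z else false.
pose S (i : index) (k : nat) := if i is inr b then `[< at_risk delta t b k >] else false.
have sumQ (F : index -> R) : \sum_(i | Q i) F i =
    \sum_(b | Num.ceil (N_low_lt I delta t * X_low I delta) <= (rank b)%:Z) F (inr b).
  by rewrite big_sumType/= big_pred0// add0r.
have eE : e = \sum_(i | Q i) fine (P [set w | S i (source i w)]).
  rewrite sumQ; apply: eq_bigr => b _; congr (fine (P _)).
  by apply/funext => w; apply/propext; split => /asboolP.
have e0 : 0 <= e by rewrite eE sumr_ge0// => i _; exact: fine_probability_ge0.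
set l := ln (3 * t%:R * ln T%:R / delta).
(* As ln T >= 1 / 2 and t >= 1, the numerator is at least 3 / 2, which exceeds delta. *)
have arg1 : 1 < 3 * t%:R * ln T%:R / delta.
  rewrite ltr_pdivlMr// mul1r (lt_le_trans d1)//; nra.
have l0 : 0 < l by exact: ln_gt0.
have disc0 : 0 <= l ^+ 2 + 8 * e * l by nra.
have sq := sqr_sqrtr disc0; have sq0 := sqrtr_ge0 (l ^+ 2 + 8 * e * l).
have cE : c = (l + Num.sqrt (l ^+ 2 + 8 * e * l)) / 2 by [].
have c0 : 0 < c by rewrite cE; lra.
(* [confP] is the positive root of c^2 = l (2 e + c). *)
have cl : c ^+ 2 = l * (2 * e + c) by rewrite cE; nra.
apply: (@le_trans _ _ (P [set w | (e + c <= \sum_(i | Q i) (S i (source i w))%:R)%R])).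
  apply: le_measure; rewrite ?inE.
  - apply: (measurable_determined source_measurable) => w w' ww' /=.
    have ww'' b : perish b w = perish b w' by exact: (ww' (inr b)).
    by under eq_bigr do rewrite ww''.
  - apply: (measurable_determined source_measurable) => w w' ww' /=.
    by under eq_bigr do rewrite ww'.
  - by move=> w /=; rewrite sumQ => /ltW.
apply: (le_trans (chernoff_count source_measurable source_independent eE c0)).
rewrite lee_fin cl mulfK; last by rewrite gt_eqF//; lra.
by rewrite expRN lnK ?posrE ?invf_div// (lt_trans _ arg1).
Qed.

End ConcentrationEvents.

(** * The good event and its probability *)

Section GoodEvent.
Variables (R : realType) (T : nat) (I : instance R T) (delta : R).

Local Notation types := (types I).
Local Notation Omega := (Omega I).
Local Notation P := (Pr I).

(** An index holds the first and last round of a window, each shifted by one, and the side of the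
    deviation; reversed windows contribute nothing. *)
Definition bad_arrivals (k : 'I_T * 'I_T * bool) : set Omega :=
  if (k.1.1 <= k.1.2)%N then
    [set w : Omega | (confN I delta k.1.1 k.1.2.+1 < (-1) ^+ k.2 *
       (arr_int k.1.1.+1 k.1.2.+1 w - exp_int I k.1.1.+1 k.1.2.+1))%R]
  else set0.

Definition bad_perish (t : 'I_T) : set Omega :=
  [set w | (eta I delta t.+1 + confP T delta t.+1 (eta I delta t.+1) <
     \sum_(b | Num.ceil (N_low_lt I delta t.+1 * X_low I delta) <= (rank b)%:Z)
     `[< at_risk delta t.+1 b (perish b w) >]%:R)%R].

Definition bad : set Omega :=
  \big[setU/set0]_k bad_arrivals k `|` \big[setU/set0]_t bad_perish t.

Lemma measurable_bad_arrivals k : measurable (bad_arrivals k).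
Proof.
rewrite /bad_arrivals; case: ifP => // k12.
apply: (measurable_determined (@source_measurable R T I)) => w w' ww'.
rewrite /= !arr_int_sub_exp//.
by under eq_bigr do rewrite ww'.
Qed.

Lemma measurable_bad_perish t : measurable (bad_perish t).
Proof.
apply: (measurable_determined (@source_measurable R T I)) => w w' ww' /=.
have ww'' b : perish b w = perish b w' by exact: (ww' (inr b)).
by rewrite /bad_perish/=; under eq_bigr do rewrite ww''.
Qed.

Lemma measurable_bad : measurable bad.
Proof.
apply: measurableU; apply: bigsetU_measurable => k _.
  exact: measurable_bad_arrivals.
exact: measurable_bad_perish.
Qed.

(** Each half costs delta: there are 2 T^2 indices of probability at most delta / (2 T^2) for
    arrivals, and a harmonic sum for perishing. *)
Lemma probability_bad : 0 < delta < 1 -> (2 <= T)%N ->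
  (P bad <= (2 * delta)%:E)%E.
Proof.
move=> delta01 T_ge2; have /andP[d0 d1] := delta01.
have T0 : 0 < T%:R :> R by rewrite ltr0n; lia.
have lnT := @ln_nat_ge_half R _ T_ge2.
have PU : (P bad <= P (\big[setU/set0]_k bad_arrivals k)
    + P (\big[setU/set0]_t bad_perish t))%E.
  apply: measureU2; apply: bigsetU_measurable => k _.
    exact: measurable_bad_arrivals.
  exact: measurable_bad_perish.
apply: (le_trans PU); rewrite mulr_natl mulr2n EFinD; apply: leeD.
  apply: (le_trans (probability_bigU _ _ _)).
    by move=> k _; exact: measurable_bad_arrivals.
  apply: (@le_trans _ _ (\sum_(k : 'I_T * 'I_T * bool) (delta / (2 * T%:R ^+ 2))%:E)%E).
    apply: lee_sum => k _; rewrite /bad_arrivals; case: ifPn => k12.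
      exact: (@arr_int_tail R T I delta delta01 k.1.1.+1 k.1.2.+1 ((-1) ^+ k.2)
        k12 (ltn_ord _) (sqrr_sign _ _)).
    by rewrite measure0 lee_fin divr_ge0 ?ltW// mulr_gt0 ?exprn_gt0.
  rewrite sumEFin sumr_const !card_prod card_ord card_bool lee_fin.
  rewrite -[X in X <= _]mulr_natr !natrM le_eqVlt; apply/orP; left; apply/eqP; field.
  by rewrite gt_eqF.
apply: (le_trans (probability_bigU _ _ _)).
  by move=> k _; exact: measurable_bad_perish.
apply: (@le_trans _ _ (\sum_(t : 'I_T) (delta / (3 * t.+1%:R * ln T%:R))%:E)%E).
  by apply: lee_sum => t _; apply: perish_tail => //; rewrite ltn_ord.
rewrite sumEFin lee_fin.
under eq_bigr => t _.
  rewrite (_ : _ / _ = delta / (3 * ln T%:R) * t.+1%:R^-1); last first.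
    by field; rewrite nat1r pnatr_eq0 gt_eqF//; lra.
  over.
rewrite -mulr_sumr.
have lnT0 : 0 < 3 * ln T%:R :> R by lra.
rewrite mulrAC ler_pdivrMr// ler_wpM2l ?(ltW d0)//.
exact: harmonic_le_ln.
Qed.

(** The implication is only almost sure, as is the lower bound 1 on arrivals. *)
Lemma good_probability (A : set Omega) : 0 < delta < 1 -> (2 <= T)%N ->
  measurable A ->
  {ae P, forall w, ~ bad w -> A w} -> ((1 - 2 * delta)%:E <= P A)%E.
Proof.
move=> delta01 T_ge2 mA gA.
have PA : (P (~` A) <= P bad)%E.
  apply: le_probability_ae; [exact: measurableC|exact: measurable_bad|].
  by apply: filterS gA => w nbA nA; apply/not_notP => /nbA.
have := le_trans PA (probability_bad delta01 T_ge2); rewrite probability_setC//.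
rewrite (probability_fin P mA) -EFinB !lee_fin; lra.
Qed.

Variable w : Omega.
Hypothesis not_bad : ~ bad w.

Lemma not_bad_arrivals t t' (b : bool) : (1 <= t <= t')%N -> (t' <= T)%N ->
  (-1) ^+ b * (arr_int t t' w - exp_int I t t') <= confN I delta t.-1 t'.
Proof.
move=> /andP[t1 tt'] t'T; rewrite leNgt; apply/negP => h; apply: not_bad; left.
have tT : (t.-1 < T)%N by lia.
have t'T' : (t'.-1 < T)%N by lia.
rewrite (bigD1 (Ordinal tT, Ordinal t'T', b))//=; left.
by rewrite /bad_arrivals/= ifT ?prednK//; lia.
Qed.

Lemma not_bad_lowN t t' : (1 <= t <= t'.+1)%N -> (t' <= T)%N ->
  N_low I delta t t' <= arr_int t t' w.
Proof.
move=> /andP[t1]; rewrite leq_eqVlt => /predU1P[->|tt'] t'T.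
  by rewrite N_low_nil /arr_int big_geq.
have := @not_bad_arrivals t t' true; rewrite t1 -ltnS tt' => /(_ isT t'T).
by rewrite /N_low expr1; lra.
Qed.

Lemma not_bad_upN t : (t < T)%N -> arr_int t.+1 T w <= N_up_gt I delta t.
Proof.
move=> tT; have := @not_bad_arrivals t.+1 T false; rewrite tT leqnn => /(_ isT isT).
by rewrite /N_up_gt expr0/=; lra.
Qed.

Lemma not_bad_perish t : (1 <= t <= T)%N ->
  \sum_(b | Num.ceil (N_low_lt I delta t * X_low I delta) <= (rank b)%:Z)
     `[< at_risk delta t b (perish b w) >]%:R
  <= eta I delta t + confP T delta t (eta I delta t).
Proof.
move=> /andP[t1 tT]; rewrite leNgt; apply/negP => h; apply: not_bad; right.
have tT' : (t.-1 < T)%N by lia.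
rewrite (bigD1 (Ordinal tT'))//=; left.
by rewrite /bad_perish/= prednK.
Qed.

End GoodEvent.

(** * Quantitative bounds *)

Section Bounds.
Variables (R : realType) (T : nat) (I : instance R T) (delta L a b : R).
Hypothesis delta01 : 0 < delta < 1.
Hypothesis T_ge2 : (2 <= T)%N.
Hypothesis E_gt0 : 0 < exp_int I 1 T.
Hypothesis feas : feasible I delta (X_low I delta).
Hypothesis a_ge0 : 0 <= a.
Hypothesis b_ge0 : 0 <= b.
Hypothesis aL : 1 / Num.sqrt T%:R <= a * L.
Hypothesis bL : 1 / Num.sqrt T%:R <= b * L_perish I delta.

Local Notation types := (types I).
Local Notation Omega := (Omega I).
Local Notation Xl := (X_low I delta).
Local Notation Lp := (L_perish I delta).
Local Notation E := (exp_int I 1 T).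
Local Notation conf := (confN I delta 0 T).
Local Notation beta := (beta_avg I).

(** With K = [conf_factor] - 1 one has Conf^2 <= T K, where the inner 1 bounds ln 2. Replacing sqrt
    K by 1 + K keeps the factor polynomial. *)
Definition conf_factor : R :=
  1 + 2 * #|types|%:R * rho_max I ^+ 2 * (1 + 2 * ln T%:R + ln (1 / delta)).

Lemma sqrtT_gt0 : 0 < Num.sqrt (T%:R : R).
Proof. by rewrite sqrtr_gt0 ltr0n; lia. Qed.

Lemma L_gt0 : 0 < L.
Proof.
have : 0 < a * L by apply: lt_le_trans aL; rewrite divr_gt0// sqrtT_gt0.
by rewrite ltNge => /negP aL'; rewrite ltNge; apply/negP => L0; apply: aL';
  exact: mulr_ge0_le0.
Qed.

Lemma L_perish_gt0 : 0 < Lp.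
Proof.
have : 0 < b * Lp by apply: lt_le_trans bL; rewrite divr_gt0// sqrtT_gt0.
by rewrite ltNge => /negP bL'; rewrite ltNge; apply/negP => L0; apply: bL';
  exact: mulr_ge0_le0.
Qed.

Lemma ln_inv_delta_ge0 : 0 <= ln (1 / delta).
Proof.
have /andP[d0 d1] := delta01.
by rewrite ln_ge0// ler_pdivlMr// mul1r ltW.
Qed.

Lemma conf_factor_ge1 : 1 <= conf_factor.
Proof.
rewrite lerDl mulr_ge0//; first by rewrite !mulr_ge0 ?exprn_ge0 ?rho_max_ge0.
have := ln_inv_delta_ge0; have := @ln_nat_ge_half R _ T_ge2; lra.
Qed.

Lemma conf_le : conf <= Num.sqrt T%:R * conf_factor.
Proof.
have /andP[d0 d1] := delta01.
have T0 : 0 < T%:R :> R by rewrite ltr0n; lia.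
have lnE : ln (2 * T%:R ^+ 2 / delta) <= 1 + 2 * ln T%:R + ln (1 / delta) :> R.
  have -> : 2 * T%:R ^+ 2 / delta = 2 * (T%:R * T%:R * (1 / delta)) by field; lra.
  rewrite !lnM ?posrE ?mulr_gt0 ?invr_gt0//.
  have := @le_ln1Dx R 1; rewrite (_ : 1 + 1 = 2); last by [].
  by move=> /(_ ltac:(lra)); lra.
pose K : R := conf_factor - 1.
have K0 : 0 <= K by have := conf_factor_ge1; rewrite /K; lra.
apply: (@le_trans _ _ (Num.sqrt (T%:R * K))).
  rewrite /confN subn0; move: lnE; set lg := ln (2 * _ / _) => lnE.
  rewrite ler_wsqrtr// /K /conf_factor [1 + _]addrC addrK.
  rewrite (_ : 2 * _ * _ * _ * lg = T%:R * (2 * #|types|%:R * rho_max I ^+ 2 * lg)).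
    rewrite ler_wpM2l ?(ltW T0)// ler_wpM2l//.
    by rewrite !mulr_ge0 ?exprn_ge0 ?rho_max_ge0.
  by ring.
rewrite sqrtrM ?(ltW T0)// ler_wpM2l ?sqrtr_ge0//.
rewrite -[leRHS]ger0_norm; last by have := conf_factor_ge1; lra.
rewrite -sqrtr_sqr ler_wsqrtr//; rewrite /K in K0 *; nra.
Qed.

Lemma N_up_gt0 : 0 < N_up I delta.
Proof. by rewrite ltr_wpDr// sqrtr_ge0. Qed.

Lemma X_low_le_beta : Xl <= beta.
Proof.
apply: (@le_trans _ _ (resource I / N_up I delta)).
  by have := L_perish_gt0; rewrite /L_perish; lra.
rewrite ler_wpM2l ?ler0n// lef_pV2 ?posrE ?N_up_gt0//.
by rewrite lerDl sqrtr_ge0.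
Qed.

Lemma exp_int_le_mu_max : E <= T%:R * mu_max I.
Proof.
rewrite exp_intE//.
apply: (@le_trans _ _ (\sum_(1 <= s < T.+1) mu_max I)); last first.
  by rewrite sumr_const_nat subSS subn0 mulr_natl.
rewrite !big_seq; apply: ler_sum => s; rewrite mem_index_iota => sT.
rewrite /mu_max; apply: (bigmax_sup_seq _ s) => //; first by rewrite mem_index_iota.
by rewrite exp_intE ?big_nat1//; lia.
Qed.

Variable w : Omega.
Hypothesis not_bad_w : ~ bad delta w.
Hypothesis arrivals_ge1_w :
  forall t (theta : types), (1 <= t <= T)%N -> (1 <= arrivals t theta w)%N.

Local Notation N := (arr_int 1 T w).

Lemma X_alg_cases t theta : (1 <= t <= T)%N ->
  X_alg delta L t theta w = Xl \/ X_alg delta L t theta w = Xl + L.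
Proof.
move=> tT; have [X0 _] := feas.
have gt : good delta L w t.
  apply: good_round => //.
  - exact: not_bad_lowN.
  - exact: not_bad_upN.
  - exact: not_bad_perish.
  - exact: ltW L_gt0.
  - exact: N_up_gt0.
by rewrite /X_alg guardrail_good//; case: ifP => _; [right|left].
Qed.

(** Without types E[N] would be 0. *)
Lemma types_gt0 : (0 < #|types|)%N.
Proof.
rewrite lt0n; apply/eqP => t0; have := E_gt0; rewrite exp_intE// big1 ?ltxx// => s _.
by rewrite big_pred0// => theta; have /card0_eq := t0; move=> /(_ theta).
Qed.

Lemma arr_int_ge : T%:R <= N.
Proof.
apply: (@le_trans _ _ (\sum_(1 <= s < T.+1) (1 : R))).
  by rewrite sumr_const_nat subSS subn0.
rewrite /arr_int !big_seq; apply: ler_sum => s; rewrite mem_index_iota => sT.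
have /card_gt0P[theta _] := types_gt0.
rewrite /arr_tot (bigD1 theta)//= -[leLHS]addr0 lerD ?sumr_ge0//.
by rewrite /arr ler1n arrivals_ge1_w.
Qed.

Lemma arr_int_dev : E - conf <= N <= E + conf.
Proof.
have := @not_bad_lowN _ _ _ _ w not_bad_w 1 T isT (leqnn _).
have := @not_bad_upN _ _ _ _ w not_bad_w 0 (ltnW T_ge2).
by rewrite /N_low /N_up_gt/= => -> ->.
Qed.

(** Both possible amounts lie within L + L_perish of B / [N_up], at most twice the maximum. Passing
    to B / N costs at most 2 beta Conf / T, since |N - [N_up]| <= 2 Conf, [N_up] >= E[N] and N >= T;
    [aL] turns Conf / T <= [conf_factor] / sqrt T into a multiple of L. *)
Lemma Delta_EF_le : Delta_EF delta L w <=
  w_max I * (2 + 2 * beta * conf_factor * a) * Num.max L Lp.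
Proof.
have T0 : 0 < T%:R :> R by rewrite ltr0n; lia.
have N0 : 0 < N := lt_le_trans T0 arr_int_ge.
have wmax0 : 0 <= w_max I by exact: bigmax_ge_id.
have C1 := conf_factor_ge1.
have beta0 : 0 <= beta by rewrite divr_ge0 ?ler0n// ltW.
have [Lmax Lpmax] : L <= Num.max L Lp /\ Lp <= Num.max L Lp.
  by rewrite !le_max !lexx orbT.
have sT := sqrtT_gt0.
have sTT : Num.sqrt T%:R ^+ 2 = T%:R :> R by rewrite sqr_sqrtr ?ltW.
have dev : `|resource I / N_up I delta - resource I / N| <=
    2 * beta * conf_factor * a * L.
  have U0 := N_up_gt0.
  have /andP[N1 N2] := arr_int_dev.
  have conf0 : 0 <= conf by exact: sqrtr_ge0.
  have UE : E <= N_up I delta by rewrite lerDl.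
  have -> : resource I / N_up I delta - resource I / N =
      resource I * (N - N_up I delta) / (N_up I delta * N).
    by field; rewrite !gt_eqF.
  rewrite normrM normfV [`|_ * N|]gtr0_norm ?mulr_gt0// normrM.
  rewrite (ger0_norm (ler0n _ _)).
  apply: (@le_trans _ _ (resource I * (2 * conf) / (E * T%:R))).
    rewrite ler_pM ?mulr_ge0 ?invr_ge0 ?mulr_ge0 ?ler0n ?(ltW U0) ?(ltW N0)//.
      by rewrite ler_wpM2l ?ler0n// ler_norml /N_up; lra.
    rewrite lef_pV2 ?posrE ?mulr_gt0// ler_pM ?(ltW E_gt0) ?(ltW T0)//.
    exact: arr_int_ge.
  have -> : resource I * (2 * conf) / (E * T%:R) = 2 * beta * (conf / T%:R).
    by rewrite /beta_avg; field; rewrite !gt_eqF.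
  have -> : 2 * beta * conf_factor * a * L = 2 * beta * (conf_factor * (a * L)).
    by ring.
  apply: ler_wpM2l; first by lra.
  apply: (@le_trans _ _ (conf_factor * (1 / Num.sqrt T%:R))).
    rewrite ler_pdivrMr// -{2}sTT (le_trans conf_le)//.
    rewrite le_eqVlt; apply/orP; left; apply/eqP; field.
    by rewrite gt_eqF.
  by rewrite ler_wpM2l//; lra.
have XB : `|Xl - resource I / N_up I delta| = Lp.
  by rewrite distrC ger0_norm// ltW// L_perish_gt0.
have C0 : 0 <= conf_factor by lra.
have bCa : 0 <= 2 * beta * conf_factor * a.
  by have := mulr_ge0 (mulr_ge0 beta0 C0) a_ge0; lra.
have M0 : 0 < Num.max L Lp by exact: lt_le_trans L_gt0 Lmax.
have bound x : `|x - resource I / N_up I delta| <= L + Lp ->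
    `|x - resource I / N| <= (2 + 2 * beta * conf_factor * a) * Num.max L Lp.
  move=> hx; have := ler_normD (x - resource I / N_up I delta)
    (resource I / N_up I delta - resource I / N).
  rewrite addrA subrK => /le_trans; apply; apply: (le_trans (lerD hx dev)).
  rewrite [leRHS]mulrDl; apply: lerD; first by lra.
  exact: ler_wpM2l.
have rhs0 : 0 <= (2 + 2 * beta * conf_factor * a) * Num.max L Lp.
  by apply: mulr_ge0; [lra|exact: ltW].
rewrite /Delta_EF -mulrA big_seq; apply: bigmax_le => [|t].
  by rewrite mulr_ge0.
rewrite mem_index_iota => tT; apply: bigmax_le => [|theta _].
  by rewrite mulr_ge0.
rewrite normrM (gtr0_norm (weight_gt0 theta)) ler_pM ?(ltW (weight_gt0 theta))//.
  exact: le_bigmax.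
apply: bound; have := L_gt0; have := L_perish_gt0.
have [->|->] := X_alg_cases theta tT; first by rewrite XB; lra.
move=> _ L0; rewrite addrAC (le_trans (ler_normD _ _))// XB (gtr0_norm L0).
by rewrite addrC.
Qed.

(** At least N [X_low] is handed out, and B = [N_up] (L_perish + [X_low]), so at most [N_up]
    L_perish + ([N_up] - N) [X_low] is left. The second term is at most 2 Conf beta, and [bL] bounds
    Conf by a multiple of T L_perish. *)
Lemma Delta_efficiency_le : Delta_efficiency delta L w <=
  (mu_max I + conf_factor + 2 * beta * conf_factor * b) * (T%:R * Lp).
Proof.
have T1 : 1 <= T%:R :> R by rewrite ler1n; lia.
have [X0 _] := feas.
have C1 := conf_factor_ge1.
have Lp0 := L_perish_gt0.
have beta0 : 0 <= beta by rewrite divr_ge0 ?ler0n// ltW.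
have /andP[N1 N2] := arr_int_dev.
have sT := sqrtT_gt0.
have sTT : Num.sqrt T%:R ^+ 2 = T%:R :> R by rewrite sqr_sqrtr// ler0n.
have step1 : Delta_efficiency delta L w <= resource I - N * Xl.
  rewrite lerD2l lerN2 /arr_int mulr_suml !big_seq; apply: ler_sum => t.
  rewrite mem_index_iota => tT; rewrite /arr_tot mulr_suml; apply: ler_sum => theta _.
  rewrite ler_wpM2l ?ler0n//; have := ltW L_gt0.
  by have [->|->] := X_alg_cases theta tT; lra.
have resE : resource I = N_up I delta * (Lp + Xl).
  by rewrite /L_perish subrK mulrC divfK// gt_eqF// N_up_gt0.
have U_le : N_up I delta <= T%:R * (mu_max I + conf_factor).
  rewrite mulrDr lerD ?exp_int_le_mu_max// (le_trans conf_le)//.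
  have s1 : 1 <= Num.sqrt T%:R :> R by rewrite -[leLHS]sqrtr1 ler_wsqrtr.
  by apply: ler_wpM2r; [lra|rewrite -[leRHS]sTT; nra].
have confT : conf <= T%:R * (conf_factor * (b * Lp)).
  apply: (le_trans conf_le).
  have -> : Num.sqrt T%:R * conf_factor = T%:R * (conf_factor * (1 / Num.sqrt T%:R)).
    by rewrite -{2}sTT; field; rewrite gt_eqF.
  by rewrite ler_wpM2l ?ler0n// ler_wpM2l//; lra.
have Xb := X_low_le_beta.
have conf0 : 0 <= conf by exact: sqrtr_ge0.
have h1 : N_up I delta * Lp <= T%:R * (mu_max I + conf_factor) * Lp.
  by apply: ler_wpM2r => //; exact: ltW.
have h2 : 2 * conf * Xl <= 2 * beta * (T%:R * (conf_factor * (b * Lp))).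
  have -> : 2 * conf * Xl = 2 * (Xl * conf) by ring.
  by rewrite -[leRHS]mulrA; apply: ler_wpM2l => //; exact: ler_pM.
have h3 : (N_up I delta - N) * Xl <= 2 * conf * Xl.
  by rewrite ler_wpM2r// /N_up; lra.
apply: (le_trans step1); rewrite resE.
have -> : N_up I delta * (Lp + Xl) - N * Xl =
  N_up I delta * Lp + (N_up I delta - N) * Xl by ring.
apply: (le_trans (lerD h1 (le_trans h3 h2))).
by rewrite le_eqVlt; apply/orP; left; apply/eqP; ring.
Qed.

End Bounds.

(** * Dependence of both metrics on the random sources alone *)

Section Measurability.
Variables (R : realType) (T : nat) (I : instance R T) (delta L : R).
Variables w w' : Omega I.
Hypothesis ww' : forall i, source i w = source i w'.

Lemma arr_determined t (theta : types I) : (1 <= t <= T)%N -> arr t theta w = arr t theta w'.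
Proof.
move=> /andP[t1 tT]; have tT' : (t.-1 < T)%N by lia.
by have := ww' (inl (Ordinal tT', theta)); rewrite /= prednK// /arr => ->.
Qed.

Lemma guardrail_determined t B : (1 <= t <= T)%N ->
  guardrail delta L t w B = guardrail delta L t w' B.
Proof.
move=> tT; rewrite /guardrail /arr_tot.
by rewrite (eq_bigr _ (fun theta _ => arr_determined theta tT)).
Qed.

(** Up to round T the algorithm reads only arrivals of rounds 1 to T and perishing times; later
    arrivals are not among the sources, hence t <= T. *)
Lemma state_determined t : (t <= T)%N -> state delta L w t = state delta L w' t.
Proof.
elim: t => // t IH tT /=; rewrite IH 1?ltnW//; case: (state _ _ _ _) => B rem.
have perishE b : perish b w = perish b w' by exact: (ww' (inr b)).
have AE : \sum_(theta : types I) arr t.+1 theta w * guardrail delta L t.+1 w B =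
    \sum_(theta : types I) arr t.+1 theta w' * guardrail delta L t.+1 w' B.
  by apply: eq_bigr => theta _; rewrite arr_determined// guardrail_determined.
rewrite AE; congr (_ - _, _).
  by apply: eq_bigl => b; rewrite perishE.
by apply/funext => b; rewrite perishE.
Qed.

Lemma X_alg_determined t theta : (1 <= t <= T)%N ->
  X_alg delta L t theta w = X_alg delta L t theta w'.
Proof.
move=> tT; rewrite /X_alg /budget guardrail_determined// state_determined//; lia.
Qed.

Lemma arr_int_determined : arr_int 1 T w = arr_int 1 T w'.
Proof.
rewrite /arr_int big_nat [RHS]big_nat; apply: eq_bigr => t tT.
by apply: eq_bigr => theta _; apply: arr_determined.
Qed.

Lemma Delta_EF_determined : Delta_EF delta L w = Delta_EF delta L w'.
Proof.
rewrite /Delta_EF big_nat [RHS]big_nat; apply: eq_bigr => t tT.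
by apply: eq_bigr => theta _; rewrite X_alg_determined// arr_int_determined.
Qed.

Lemma Delta_efficiency_determined :
  Delta_efficiency delta L w = Delta_efficiency delta L w'.
Proof.
rewrite /Delta_efficiency big_nat [in RHS]big_nat; congr (_ - _).
apply: eq_bigr => t tT; apply: eq_bigr => theta _.
by rewrite X_alg_determined// arr_determined.
Qed.

End Measurability.

(** * Polynomials hidden in the asymptotic inequalities *)

Section HiddenFactors.
Variable R : realType.
Implicit Types p q : mpoly 9 R.

Lemma hidden_factorD p q : hidden_factor p -> hidden_factor q -> hidden_factor (p + q).
Proof. by move=> hp hq m; rewrite mcoeffD addr_ge0. Qed.

Lemma hidden_factorM p q : hidden_factor p -> hidden_factor q -> hidden_factor (p * q).
Proof. by move=> hp hq m; rewrite mcoeffM sumr_ge0// => k _; rewrite mulr_ge0. Qed.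

Lemma hidden_factorC (c : R) : 0 <= c -> hidden_factor (mpolyC 9 c).
Proof. by move=> c0 m; rewrite mcoeffC mulr_ge0. Qed.

Definition var (i : 'I_9) : mpoly 9 R := mpolyX R (mnm1 i).

Lemma hidden_factor_var i : hidden_factor (var i).
Proof. by move=> m; rewrite mcoeffX. Qed.

(** Makes the values of [p1] and [p2] usable as the nonnegative factors [a] and [b] above. *)
Lemma meval_ge0 (v : 'I_9 -> R) p : (forall i, 0 <= v i) -> hidden_factor p ->
  0 <= meval v p.
Proof.
move=> v0 hp; rewrite mevalE sumr_ge0// => m _; rewrite mulr_ge0// prodr_ge0// => i _.
by rewrite exprn_ge0.
Qed.

(* Indices of variables are positions in [params]. *)
Definition conf_poly : mpoly 9 R :=
  mpolyC 9 1 + mpolyC 9 2 * var 1 * (var 6 * var 6)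
    * (mpolyC 9 1 + mpolyC 9 2 * var 7 + var 8).

Definition envy_poly p : mpoly 9 R :=
  var 2 * (mpolyC 9 2 + mpolyC 9 2 * var 0 * conf_poly * p).

Definition efficiency_poly p : mpoly 9 R :=
  var 3 + conf_poly + mpolyC 9 2 * var 0 * conf_poly * p.

Ltac hidden_factor :=
  repeat first [assumption | exact: hidden_factor_var
    | apply: hidden_factorC; (exact: ler01 || exact: ler0n)
    | apply: hidden_factorD | apply: hidden_factorM].

Lemma hidden_factor_conf : hidden_factor conf_poly.
Proof. hidden_factor. Qed.

Lemma hidden_factor_envy p : hidden_factor p -> hidden_factor (envy_poly p).
Proof. by move=> hp; have hc := hidden_factor_conf; hidden_factor. Qed.

Lemma hidden_factor_efficiency p : hidden_factor p -> hidden_factor (efficiency_poly p).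
Proof. by move=> hp; have hc := hidden_factor_conf; hidden_factor. Qed.

Variables (T : nat) (I : instance R T) (delta : R).

Lemma meval_conf_poly : meval (params I delta) conf_poly = conf_factor I delta.
Proof. by rewrite /conf_poly /var !(mevalD, mevalM, mevalC, mevalXU). Qed.

Lemma meval_envy_poly p : meval (params I delta) (envy_poly p) =
  w_max I * (2 + 2 * beta_avg I * conf_factor I delta * meval (params I delta) p).
Proof.
rewrite /envy_poly /var; have := meval_conf_poly; move: conf_poly => c hc.
by rewrite !(mevalD, mevalM, mevalC, mevalXU) hc.
Qed.

Lemma meval_efficiency_poly p : meval (params I delta) (efficiency_poly p) =
  mu_max I + conf_factor I delta
    + 2 * beta_avg I * conf_factor I delta * meval (params I delta) p.
Proof.
rewrite /efficiency_poly /var; have := meval_conf_poly; move: conf_poly => c hc.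
by rewrite !(mevalD, mevalM, mevalC, mevalXU) hc.
Qed.

Lemma params_ge0 i : (2 <= T)%N -> 0 < delta < 1 -> 0 < exp_int I 1 T ->
  0 <= params I delta i.
Proof.
move=> T2 delta01 E0; have s2max : 0 <= sigma2_max I by exact: bigmax_ge_id.
have lnT := @ln_nat_ge_half R _ T2.
rewrite /params; case: i => -[|[|[|[|[|[|[|[|[|//]]]]]]]]] _ /=.
- by rewrite divr_ge0 ?ler0n// ltW.
- by rewrite ler0n.
- exact: bigmax_ge_id.
- exact: bigmax_ge_id.
- have s2 t theta : 0 <= sigma2 (I := I) t theta by rewrite fine_ge0// variance_ge0.
  by rewrite /sigma2_min; apply: le_bigmin => // t _; apply: le_bigmin.
- by [].
- exact: rho_max_ge0.
- lra.
- exact: ln_inv_delta_ge0.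
Qed.

End HiddenFactors.

(** * Assembly of the bounds for large T *)

Theorem corollary2 (R : realType) (p1 p2 : mpoly 9 R)
    (hp1 : hidden_factor p1) (hp2 : hidden_factor p2) :
  exists q1 q2 : mpoly 9 R,
    [/\ hidden_factor q1, hidden_factor q2 &
    forall (I : forall T : nat, instance R T) (delta L : nat -> R),
      (forall T, 0 < delta T < 1) ->
      (fun T => exp_int (I T) 1 T) =Theta_\oo (fun T => T%:R : R) ->
      (fun T => beta_avg (I T)) =Theta_\oo (fun _ => 1 : R) ->
      (\forall T \near \oo, feasible (I T) (delta T) (X_low (I T) (delta T))) ->
      L @ \oo --> (0 : R) ->
      (\forall T \near \oo,
        1 / Num.sqrt T%:R <= meval (params (I T) (delta T)) p1 * L T) ->
      (\forall T \near \oo,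
        1 / Num.sqrt T%:R <=
          meval (params (I T) (delta T)) p2 * L_perish (I T) (delta T)) ->
      \forall T \near \oo,
        ((1 - 2 * delta T)%:E <=
         Pr (I T) [set w |
           (Delta_EF (delta T) (L T) w <=
             meval (params (I T) (delta T)) q1 *
               Num.max (L T) (L_perish (I T) (delta T)))%R /\
           (Delta_efficiency (delta T) (L T) w <=
             meval (params (I T) (delta T)) q2 *
               (T%:R * L_perish (I T) (delta T)))%R])%E].
Proof.
(* The witnesses depend only on [p1] and [p2], so they are uniform over all sequences of
   instances. *)
exists (envy_poly p1), (efficiency_poly p2); split.
- exact: hidden_factor_envy.
- exact: hidden_factor_efficiency.
move=> I delta L delta01 E_Theta _ feas _ p1L p2L.
have E_gt0 : \forall T \near \oo, 0 < exp_int (I T) 1 T.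
  (* The lower half of the Theta bound gives |E[N]| >= k1 T with k1 > 0, and E[N] is nonnegative. *)
  move: E_Theta; rewrite eqThetaE qualifE => /asboolP[[k1 k2] /= /andP[k1_gt0 _] hk].
  near=> T.
  have [hT _] : k1 * `|T%:R| <= `|exp_int (I T) 1 T| /\
    `|exp_int (I T) 1 T| <= k2 * `|T%:R| by near: T.
  have T0 : 0 < T%:R :> R by rewrite ltr0n; near: T; exact: nbhs_infty_gt.
  have E_ge0 : 0 <= exp_int (I T) 1 T.
    rewrite fine_ge0// expectation_ge0// => w.
    by rewrite sumr_ge0// => s _; exact: arr_tot_ge0.
  rewrite lt0r E_ge0 andbT -normr_gt0 (lt_le_trans _ hT)// mulr_gt0//.
  by rewrite normr_gt0 gt_eqF.
near=> T.
have T2 : (2 <= T)%N by near: T; exact: nbhs_infty_ge.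
have E0 : 0 < exp_int (I T) 1 T by near: T.
have feasT : feasible (I T) (delta T) (X_low (I T) (delta T)) by near: T.
have aL : 1 / Num.sqrt T%:R <= meval (params (I T) (delta T)) p1 * L T by near: T.
have bL : 1 / Num.sqrt T%:R <=
  meval (params (I T) (delta T)) p2 * L_perish (I T) (delta T) by near: T.
have par0 i := params_ge0 i T2 (delta01 T) E0.
have a0 := meval_ge0 par0 hp1; have b0 := meval_ge0 par0 hp2.
rewrite meval_envy_poly meval_efficiency_poly.
apply: good_probability => //.
  apply: (measurable_determined (@source_measurable R T (I T))) => w w' ww' /=.
  by rewrite (Delta_EF_determined _ _ ww') (Delta_efficiency_determined _ _ ww').
(* Finitely many almost sure bounds, one for each round and type, hold simultaneously. *)
have ge1 : {ae Pr (I T), forall w, forall (k : 'I_T * types (I T)),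
    (1 <= arrivals k.1.+1 k.2 w)%N}.
  by apply: filter_forall => k; apply: arrivals_ge1; rewrite ltn_ord.
apply: filterS ge1 => w ge1 nbad.
have ge1' t (theta : types (I T)) : (1 <= t <= T)%N -> (1 <= arrivals t theta w)%N.
  move=> /andP[t1 tT]; have tT' : (t.-1 < T)%N by lia.
  by have := ge1 (Ordinal tT', theta); rewrite /= prednK.
split; first exact: (@Delta_EF_le _ _ _ _ _ _ (meval (params (I T) (delta T)) p2)).
exact: (@Delta_efficiency_le _ _ _ _ _ (meval (params (I T) (delta T)) p1)).
Unshelve. all: by end_near.
Qed.
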